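(* Let $\lambda$ be a nonzero dominant integral weight of $\mathfrak g$ and $V=V(\lambda)$. For each weight $\mu$ of $V$, there exists a unique invertible element $\ell_\mu$ of $\mathbf U_{\mathrm R}^\lambda(\mathfrak g)$ such that $$\mathscr L_\mu=\mathrm{Id}_{V_\mu}\otimes\ell_\mu.$$ Moreover, these elements are grouplike and satisfy $$\ell_\mu x_\beta\ell_\mu^{-1}=q^{-(\mu,\beta)}x_\beta\qquad\text{for all }\beta\in\mathsf Q,\ x_\beta\in\mathbf U_{\mathrm R}^\lambda(\mathfrak g)_\beta.$$
   Context: **Lie data.** $\mathfrak g$ is a complex simple Lie algebra with Cartan subalgebra $\mathfrak h$, simple roots $\{\alpha_i\}_{i\in\mathbf I}$ and invariant non-degenerate symmetric bilinear form $(\cdot,\cdot)$ normalized so that short simple roots have square length $2$; $d_i=(\alpha_i,\alpha_i)/2$, $a_{ij}=(\alpha_i,\alpha_j)/d_i$ (Cartan matrix), $q_i=q^{d_i}$. $\mathsf Q=\bigoplus_i\mathbb Z\alpha_i$ is the root lattice, $\mathsf Q_+=\bigoplus_i\mathbb Z_{\ge0}\alpha_i$, $\mathsf Q_-=-\mathsf Q_+$, and $\mathsf Q_+^\beta=\{\nu\in\mathsf Q_+:\beta-\nu\in\mathsf Q_+\}$. $\begin{bmatrix}n\\ r\end{bmatrix}_q=\frac{[n]_q!}{[r]_q![n-r]_q!}$ with $[m]_q=\frac{q^m-q^{-m}}{q-q^{-1}}$. **Quantum group.** $U_q(\mathfrak g)$ is the unital associative $\mathbb Q(q)$-algebra generated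 by $E_i,F_i$ ($i\in\mathbf I$), $K_\mu^{\pm1}$ ($\mu\in\mathsf Q$) with relations $K_\mu K_\gamma=K_{\mu+\gamma}$, $K_0=1$, $K_\mu E_jK_\mu^{-1}=q^{(\mu,\alpha_j)}E_j$, $K_\mu F_jK_\mu^{-1}=q^{-(\mu,\alpha_j)}F_j$, $[E_i,F_j]=\delta_{ij}\frac{K_{\alpha_i}-K_{-\alpha_i}}{q_i-q_i^{-1}}$, and for $i\neq j$ the $q$-Serre relations $\sum_{b=0}^{1-a_{ij}}(-1)^b\begin{bmatrix}1-a_{ij}\\ b\end{bmatrix}_{q_i}Z_i^bZ_jZ_i^{1-a_{ij}-b}=0$ for $Z=E$ and $Z=F$. With $K_i=K_{\alpha_i}$ its coproduct is $\Delta(K_\mu)=K_\mu\otimes K_\mu$, $\Delta(E_i)=E_i\otimes K_i+1\otimes E_i$, $\Delta(F_i)=F_i\otimes1+K_i^{-1}\otimes F_i$. It is $\mathsf Q$-graded: the degree $\beta$ part is $\{x:K_\mu xK_\mu^{-1}=q^{(\beta,\mu)}x\ \forall\mu\in\mathsf Q\}$. $U_q(\mathfrak n^+)$, $U_q(\mathfrak n^-)$ are the subalgebras generated by the $E_i$, resp. $F_i$; $U_q(\mathfrak b^\pm)$ is generated by $U_q(\mathfrak n^\pm)$ and the $K_\beta$. **The module $V$.** $V$ is the finite-dimensional irreducible type $1$ $U_q(\mathfrak g)$-module of highest weight $\lambda$, $\pi:U_q(\mathfrak g)\to\mathrm{End}(V)$ its action, $V=\bigoplus_\mu V_\mu$ with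 $V_\mu=\{w:K_\beta w=q^{(\mu,\beta)}w\ \forall\beta\in\mathsf Q\}$, $\mathsf\Lambda_\lambda=\{\mu:V_\mu\ne0\}$. $\mathrm{End}(V)_\beta=\{X:X(V_\mu)\subset V_{\mu+\beta}\ \forall\mu\}$. For $T\in\mathrm{End}(V)\otimes\mathscr U$, $T_\beta$ is its component in $\mathrm{End}(V)_\beta\otimes\mathscr U$, $T_1,T_2\in\mathrm{End}(V)^{\otimes2}\otimes\mathscr U$ denote $T$ placed in the first/second $\mathrm{End}(V)$-factor, and $T_{[1]},T_{[2]}\in\mathrm{End}(V)\otimes\mathscr U^{\otimes2}$ denote $T$ placed in the first/second $\mathscr U$-factor. **The $R$-matrix.** $\Psi$ is the automorphism of $U_q(\mathfrak g)^{\otimes2}$ fixing $K_i\otimes1$, $1\otimes K_i$, with $E_i\otimes1\mapsto E_i\otimes K_i^{-1}$, $F_i\otimes1\mapsto F_i\otimes K_i$, $1\otimes E_i\mapsto K_i^{-1}\otimes E_i$, $1\otimes F_i\mapsto K_i\otimes F_i$; $\Delta_\Psi=\Psi\circ\Delta$. $\{\mathscr R_\nu^+\}_{\nu\in\mathsf Q_+}$ is the unique family with $\mathscr R^+_\nu\in U_q(\mathfrak n^+)_\nu\otimes U_q(\mathfrak n^-)_{-\nu}$, $\mathscr R_0^+=1$ and, for all $\beta\in\mathsf Q_+$, $x\in U_q(\mathfrak b^+)$, $y\in U_q(\mathfrak b^-)$, $\sum_{\nu\in\mathsf Q_+^\beta}(\mathscr R_\nu^+\Delta(x)_{\beta-\nu}-\Delta_\Psi^{\mathrm{op}}(x)_{\beta-\nu}\mathscr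 R_\nu^+)=0=\sum_{\nu\in\mathsf Q_+^\beta}(\mathscr R_\nu^+\Delta(y)^{\nu-\beta}-\Delta_\Psi^{\mathrm{op}}(y)^{\nu-\beta}\mathscr R_\nu^+)$, where $u_\gamma$, $u^\gamma$ are the components of $u$ whose first, resp. second, tensor leg has degree $\gamma$ (for example $\mathscr R^+_{\alpha_i}=(q_i-q_i^{-1})E_i\otimes F_i$). $\mathscr R^+=\sum_\nu\mathscr R^+_\nu$ (only finitely many terms act nontrivially on a finite-dimensional module). $\mathscr D=\sum_{\mu,\gamma\in\mathsf\Lambda_\lambda}q^{(\mu,\gamma)-(\lambda,\lambda)}\mathrm{Id}_{V_\mu\otimes V_\gamma}$ and $\mathrm R=\mathscr D\cdot(\pi\otimes\pi)(\mathscr R^+)\in\mathrm{End}(V\otimes V)$. **The algebra $\mathbf U_{\mathrm R}^\lambda(\mathfrak g)$.** It is the unital associative $\mathbb Q(q)$-algebra generated by the coefficients of two matrices $\mathrm L^\pm\in\bigoplus_{\beta\in\mathsf Q_\pm}\mathrm{End}(V)_\beta\otimes\mathbf U_{\mathrm R}^\lambda(\mathfrak g)$ (that is, $\mathrm L^\pm=\sum_kX_k^\pm\otimes l_k^\pm$ with $\{X_k^\pm\}$ a basis of $\bigoplus_{\beta\in\mathsf Q_\pm}\mathrm{End}(V)_\beta$ and the $l_k^\pm$ the generators), subject to $\mathscr L^+\mathscr L^-=I=\mathscr L^-\mathscr L^+$ where $\mathscr L^\pm:=\mathrm L^\pm_0$, and $\mathrm R\mathrm L_1^+\mathrm L_2^-=\mathrm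 L_2^-\mathrm L_1^+\mathrm R$, $\mathrm R\mathrm L_1^\pm\mathrm L_2^\pm=\mathrm L_2^\pm\mathrm L_1^\pm\mathrm R$. Its coproduct is $\Delta_{\mathrm R}(\mathrm L^\pm)=\mathrm L^\pm_{[1]}\mathrm L^\pm_{[2]}$, its counit is $\varepsilon_{\mathrm R}(\mathrm L^\pm)=I$, and it carries the unique $\mathsf Q$-grading such that $\mathrm L^\pm_\beta\in\mathrm{End}(V)_\beta\otimes\mathbf U_{\mathrm R}^\lambda(\mathfrak g)_\beta$ for all $\beta\in\mathsf Q$. **The blocks $\mathscr L_\mu$.** Since $\mathrm{End}(V)_0=\bigoplus_\mu\mathrm{End}(V_\mu)$ and $\mathscr L^-=(\mathscr L^+)^{-1}$, one has $\mathscr L^\pm=\sum_{\mu\in\mathsf\Lambda_\lambda}\mathscr L_\mu^{\pm1}$ with $\mathscr L_\mu\in\mathrm{End}(V_\mu)\otimes\mathbf U_{\mathrm R}^\lambda(\mathfrak g)$. *)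

(* Defs.v *)
From HB Require Import structures.
From mathcomp Require Import all_boot all_order all_algebra finmap.
From mathcomp Require Import mxtens.
From mathcomp Require Import boolp classical_sets fsbigop.
From mathcomp Require Import monalg.

Set Implicit Arguments.
Unset Strict Implicit.
Unset Printing Implicit Defensive.

Import Order.TTheory GRing.Theory Num.Theory.
Local Open Scope ring_scope.
Local Open Scope quotient_scope.

(* Unital associative K-algebras, given by a central ring morphism from K.  *)
(* GRing.Algebra would force 1 != 0, which cannot be guaranteed for the     *)
(* quotient of a ring by an arbitrary two-sided ideal.                      *)

HB.mixin Record PzRing_isKAlg (K : comNzRingType) A of GRing.PzRing A := {
  kin : K -> A;
  kin1 : kin 1 = 1;
  kinD : {morph kin : a b / a + b};
  kinM : {morph kin : a b / a * b};
  kin_central : forall (a : K) (x : A), kin a * x = x * kin a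
}.

#[short(type="kalgType")]
HB.structure Definition KAlg (K : comNzRingType) :=
  { A of PzRing_isKAlg K A & GRing.PzRing A }.

Notation "a %:K" := (kin a) (at level 2, left associativity, format "a %:K")
  : ring_scope.

Section KAlgInstances.
Variable K : comNzRingType.

HB.instance Definition _ := PzRing_isKAlg.Build K K^o
  (erefl 1 : idfun (1 : K) = 1 :> K^o) (fun _ _ => erefl) (fun _ _ => erefl)
  (fun a x => mulrC (a : K) x).

Lemma scalar_mx_kM n : {morph (@scalar_mx K n) : a b / a * b}.
Proof. by move=> a b; rewrite scalar_mxM. Qed.

Lemma scalar_mx_kC n (a : K) (x : 'M[K]_n) : a%:M * x = x * a%:M.
Proof. exact: (comm_scalar_mx a x). Qed.

HB.instance Definition _ n := PzRing_isKAlg.Build K 'M[K]_n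
  (erefl (1 : 'M[K]_n)) (@raddfD _ _ (@scalar_mx K n))
  (@scalar_mx_kM n) (@scalar_mx_kC n).

End KAlgInstances.

Section AlgHom.
Variables (K : comNzRingType) (A B : kalgType K).

Definition alg_hom (f : A -> B) : Prop :=
  [/\ forall x y, f (x + y) = f x + f y, forall x y, f (x * y) = f x * f y
    & forall a : K, f a%:K = a%:K].

Inductive subalg (S : A -> Prop) : A -> Prop :=
| subalg_gen x : S x -> subalg S x
| subalg_scalar (a : K) : subalg S a%:K
| subalg_add x y : subalg S x -> subalg S y -> subalg S (x + y)
| subalg_mul x y : subalg S x -> subalg S y -> subalg S (x * y).

Definition is_inverse (x y : A) : Prop := x * y = 1 /\ y * x = 1.
Definition invertible (x : A) : Prop := exists y, is_inverse x y.

End AlgHom.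

Section KAlgTheory.
Variables (K : comNzRingType) (A B : kalgType K).

Lemma kin0 : (0 : K)%:K = 0 :> A.
Proof. by apply: (addrI (0 : K)%:K); rewrite -kinD !addr0. Qed.

Variable (f : A -> B).
Hypothesis fh : alg_hom f.

Lemma alg_homD x y : f (x + y) = f x + f y. Proof. by case: fh. Qed.
Lemma alg_homM x y : f (x * y) = f x * f y. Proof. by case: fh. Qed.
Lemma alg_homK (a : K) : f a%:K = a%:K. Proof. by case: fh. Qed.
Lemma alg_hom0 : f 0 = 0.
Proof. by apply: (addrI (f 0)); rewrite -alg_homD !addr0. Qed.
Lemma alg_homN x : f (- x) = - f x.
Proof. by apply: (addIr (f x)); rewrite -alg_homD !addNr alg_hom0. Qed.
Lemma alg_homB x y : f (x - y) = f x - f y.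
Proof. by rewrite alg_homD alg_homN. Qed.

End KAlgTheory.

(* ------------------------------------------------------------------------ *)

Definition freealg (K : comNzRingType) (X : choiceType) := {malg K[{fmonom X}]}.

HB.lock Definition fgen (K : comNzRingType) (X : choiceType) (x : X) :
  freealg K X := mkmalgU (fmu x) 1.

(* Multiplication is that of malg, locked to keep unification tractable.     *)
HB.lock Definition fmul (K : comNzRingType) (X : choiceType)
  (x y : freealg K X) : freealg K X := fgmul x y.

Section FreeAlg.
Variables (K : comNzRingType) (X : choiceType).
Local Notation F := (freealg K X).

HB.instance Definition _ := GRing.Zmodule.on F.

Lemma fmulA : associative (@fmul K X).
Proof. by move=> x y z; rewrite fmul.unlock fgmulA. Qed.
Lemma fmul1l : left_id (fgone {fmonom X} K : F) (@fmul K X).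
Proof. by move=> x; rewrite fmul.unlock fgmul1g. Qed.
Lemma fmul1r : right_id (fgone {fmonom X} K : F) (@fmul K X).
Proof. by move=> x; rewrite fmul.unlock fgmulg1. Qed.
Lemma fmulDl : left_distributive (@fmul K X) +%R.
Proof. by move=> x y z; rewrite fmul.unlock fgmulgDl. Qed.
Lemma fmulDr : right_distributive (@fmul K X) +%R.
Proof. by move=> x y z; rewrite fmul.unlock fgmulgDr. Qed.

HB.instance Definition _ := GRing.Zmodule_isPzRing.Build F
  fmulA fmul1l fmul1r fmulDl fmulDr.

Lemma freealg_mulE (x y : F) : x * y = fgmul x y.
Proof. by rewrite [LHS]/GRing.mul /= fmul.unlock. Qed.

Definition fconst (a : K) : F := a%:MP.

Lemma fconst1 : fconst 1 = 1. Proof. by []. Qed.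
Lemma fconstD : {morph fconst : a b / a + b}. Proof. exact: monalgUD. Qed.
Lemma fconstM : {morph fconst : a b / a * b}.
Proof. by move=> a b; rewrite freealg_mulE; exact: mpolyCM. Qed.
Lemma fconst_central (a : K) (x : F) : fconst a * x = x * fconst a.
Proof.
rewrite !freealg_mulE fgmulUg fgmulgU; apply: eq_bigr => m _.
by rewrite mulrC mulm1 mul1m.
Qed.

HB.instance Definition _ := PzRing_isKAlg.Build K F
  fconst1 fconstD fconstM fconst_central.

Variables (A : kalgType K) (f : X -> A).

Definition free_eval (g : F) : A :=
  \sum_(m <- msupp g) (mcoeff m g)%:K * \prod_(x <- (m : seq X)) f x.

Lemma free_evalEw (d : {fset {fmonom X}}) (g : F) : (msupp g `<=` d)%fset ->
  free_eval g = \sum_(m <- d) (mcoeff m g)%:K * \prod_(x <- (m : seq X)) f x.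
Proof.
move=> le; rewrite [LHS](big_fset_incl _ le) => //= m _ /mcoeff_outdom ->.
by rewrite kin0 mul0r.
Qed.

Lemma free_evalU (a : K) (m : {fmonom X}) :
  free_eval (mkmalgU m a) = a%:K * \prod_(x <- (m : seq X)) f x.
Proof. by rewrite (free_evalEw msuppU_le) big_seq_fset1 mcoeffUU. Qed.

Lemma free_evalD (g h : F) : free_eval (g + h) = free_eval g + free_eval h.
Proof.
pose d := (msupp g `|` msupp h)%fset.
rewrite (@free_evalEw d) ?msuppD_le // (@free_evalEw d g) ?fsubsetUl //.
rewrite (@free_evalEw d h) ?fsubsetUr // -big_split /=.
by apply: eq_bigr => m _; rewrite mcoeffD kinD mulrDl.
Qed.

Lemma free_eval0 : free_eval 0 = 0.
Proof. by rewrite /free_eval msupp0 big_seq_fset0. Qed.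

Lemma free_eval_hom : alg_hom free_eval.
Proof.
split=> [|g h|a]; first exact: free_evalD.
- rewrite freealg_mulE /fgmul.
  rewrite (big_morph free_eval free_evalD free_eval0) mulr_suml.
  apply: eq_bigr => m _.
  rewrite (big_morph free_eval free_evalD free_eval0) mulr_sumr.
  apply: eq_bigr => m' _; rewrite free_evalU fmM big_cat /= kinM.
  by rewrite -!mulrA; congr (_ * _); rewrite [LHS]mulrA kin_central -mulrA.
- by rewrite free_evalU fm1 big_nil mulr1.
Qed.

Lemma free_eval_gen (x : X) : free_eval (fgen K x) = f x.
Proof. by rewrite fgen.unlock free_evalU fmU big_seq1 kin1 mul1r. Qed.

End FreeAlg.


Section Quotient.
Variables (K : comNzRingType) (A : kalgType K) (S : A -> Prop).

Inductive ideal : A -> Prop :=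
| ideal_gen x : S x -> ideal x
| ideal_zero : ideal 0
| ideal_add x y : ideal x -> ideal y -> ideal (x + y)
| ideal_mull a x : ideal x -> ideal (a * x)
| ideal_mulr x a : ideal x -> ideal (x * a).

Lemma ideal_opp x : ideal x -> ideal (- x).
Proof. by move=> /(ideal_mull (-1)); rewrite mulN1r. Qed.

Definition ideal_eq (x y : A) : bool := `[< ideal (x - y) >].

Lemma ideal_eqP : equiv_class_of ideal_eq.
Proof.
split=> [x|x y|y x z].
- by apply/asboolP; rewrite subrr; exact: ideal_zero.
- by apply/asboolP/asboolP => /ideal_opp; rewrite opprB.
- move=> /asboolP xy /asboolP yz; apply/asboolP.
  by rewrite -(subrKA y); exact: ideal_add.
Qed.

Canonical ideal_equiv := EquivRelPack ideal_eqP.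

Definition kquot := {eq_quot ideal_equiv}.
HB.instance Definition _ := Choice.on kquot.
HB.instance Definition _ := EqQuotient.on kquot.

Definition qclass (x : A) : kquot := \pi_kquot x.

Lemma qclass_eq (x y : A) : qclass x = qclass y <-> ideal (x - y).
Proof.
split; first by move=> /eqmodP /asboolP.
by move=> h; apply/eqmodP/asboolP.
Qed.

Lemma ideal_repr (x : A) : ideal (repr (qclass x) - x).
Proof. by apply/qclass_eq; rewrite /qclass reprK. Qed.

Definition qadd (u v : kquot) : kquot := qclass (repr u + repr v).
Definition qopp (u : kquot) : kquot := qclass (- repr u).
Definition qmul (u v : kquot) : kquot := qclass (repr u * repr v).

Lemma qaddE x y : qadd (qclass x) (qclass y) = qclass (x + y).
Proof. by apply/qclass_eq; rewrite opprD addrACA; apply: ideal_add; apply: ideal_repr. Qed.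

Lemma qoppE x : qopp (qclass x) = qclass (- x).
Proof. by apply/qclass_eq; rewrite -opprD; apply/ideal_opp/ideal_repr. Qed.

Lemma qmulE x y : qmul (qclass x) (qclass y) = qclass (x * y).
Proof.
apply/qclass_eq; rewrite -(subrKA (x * repr (qclass y))) -mulrBl -mulrBr.
by apply: ideal_add; [apply: ideal_mulr|apply: ideal_mull]; apply: ideal_repr.
Qed.

Lemma qclassP (P : kquot -> Prop) : (forall x, P (qclass x)) -> forall u, P u.
Proof. by move=> h u; rewrite -[u]reprK; apply: h. Qed.

Lemma qaddA : associative qadd.
Proof. by do 3!elim/qclassP=> ?; rewrite !qaddE addrA. Qed.
Lemma qaddC : commutative qadd.
Proof. by do 2!elim/qclassP=> ?; rewrite !qaddE addrC. Qed.
Lemma qadd0 : left_id (qclass 0) qadd.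
Proof. by elim/qclassP=> ?; rewrite !qaddE add0r. Qed.
Lemma qaddN : left_inverse (qclass 0) qopp qadd.
Proof. by elim/qclassP=> ?; rewrite qoppE qaddE addNr. Qed.

HB.instance Definition _ := GRing.isZmodule.Build kquot qaddA qaddC qadd0 qaddN.

Lemma qmulA : associative qmul.
Proof. by do 3!elim/qclassP=> ?; rewrite !qmulE mulrA. Qed.
Lemma qmul1l : left_id (qclass 1) qmul.
Proof. by elim/qclassP=> ?; rewrite qmulE mul1r. Qed.
Lemma qmul1r : right_id (qclass 1) qmul.
Proof. by elim/qclassP=> ?; rewrite qmulE mulr1. Qed.
Lemma qmulDl : left_distributive qmul qadd.
Proof. by do 3!elim/qclassP=> ?; rewrite !(qaddE, qmulE) mulrDl. Qed.
Lemma qmulDr : right_distributive qmul qadd.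
Proof. by do 3!elim/qclassP=> ?; rewrite !(qaddE, qmulE) mulrDr. Qed.

HB.instance Definition _ :=
  GRing.Zmodule_isPzRing.Build kquot qmulA qmul1l qmul1r qmulDl qmulDr.

Lemma qclassD x y : qclass (x + y) = qclass x + qclass y.
Proof. exact: esym (qaddE x y). Qed.
Lemma qclassM x y : qclass (x * y) = qclass x * qclass y.
Proof. exact: esym (qmulE x y). Qed.

Lemma qkin1 : qclass (1 : K)%:K = 1.
Proof. by rewrite kin1. Qed.
Lemma qkinD : {morph (fun a : K => qclass a%:K) : a b / a + b}.
Proof. by move=> a b; rewrite kinD qclassD. Qed.
Lemma qkinM : {morph (fun a : K => qclass a%:K) : a b / a * b}.
Proof. by move=> a b; rewrite kinM qclassM. Qed.
Lemma qkin_central (a : K) (u : kquot) : qclass a%:K * u = u * qclass a%:K.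
Proof. by elim/qclassP: u => x; rewrite -!qclassM kin_central. Qed.

HB.instance Definition _ := PzRing_isKAlg.Build K kquot
  qkin1 qkinD qkinM qkin_central.

Lemma qclass_hom : alg_hom qclass.
Proof. by split=> //; [exact: qclassD | exact: qclassM]. Qed.

Variables (B : kalgType K) (f : A -> B).

Definition quot_lift (u : kquot) : B := f (repr u).

Hypotheses (fh : alg_hom f) (fS : forall x, S x -> f x = 0).

Lemma quot_liftE x : quot_lift (qclass x) = f x.
Proof.
have f_ideal y : ideal y -> f y = 0.
  elim=> {y} [y /fS//||y z _ fy _ fz|a y _ fy|y a _ fy].
  - exact: alg_hom0.
  - by rewrite (alg_homD fh) fy fz addr0.
  - by rewrite (alg_homM fh) fy mulr0.
  - by rewrite (alg_homM fh) fy mul0r.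
apply/eqP; rewrite -subr_eq0 -(alg_homB fh); apply/eqP/f_ideal/ideal_repr.
Qed.

Lemma quot_lift_hom : alg_hom quot_lift.
Proof.
split=> [|| a]; last by rewrite quot_liftE (alg_homK fh).
- by do 2!elim/qclassP=> ?; rewrite -qclassD !quot_liftE (alg_homD fh).
- by do 2!elim/qclassP=> ?; rewrite -qclassM !quot_liftE (alg_homM fh).
Qed.

End Quotient.

(* The algebra with generators X and relations r = 0 for r in S.            *)
Definition presalg (K : comNzRingType) (X : choiceType)
  (S : freealg K X -> Prop) : kalgType K := kquot S.

Section Presented.
Variables (K : comNzRingType) (X : choiceType) (S : freealg K X -> Prop).

Definition pgen (x : X) : presalg S := qclass S (fgen K x).

Definition pres_lift (B : kalgType K) (f : X -> B) : presalg S -> B :=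
  @quot_lift _ _ S B (free_eval f).

Variables (B : kalgType K) (f : X -> B).
Hypothesis fS : forall r, S r -> free_eval f r = 0.

Lemma pres_lift_hom : alg_hom (pres_lift f).
Proof. exact: quot_lift_hom (free_eval_hom f) fS. Qed.

Lemma pres_lift_gen x : pres_lift f (pgen x) = f x.
Proof.
by rewrite /pres_lift (quot_liftE (free_eval_hom f) fS) free_eval_gen.
Qed.

End Presented.

(* The tensor product of A and B is presented by commuting copies of both.  *)
Section Tensor.
Variables (K : comNzRingType) (A B : kalgType K).

Local Notation l := (fun x : A => fgen K (inl x) : freealg K (A + B)%type).
Local Notation r := (fun y : B => fgen K (inr y) : freealg K (A + B)%type).

Variant tens_rel : freealg K (A + B)%type -> Prop :=
| tens_addl x x' : tens_rel (l (x + x') - (l x + l x'))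
| tens_mull x x' : tens_rel (l (x * x') - l x * l x')
| tens_scall (a : K) : tens_rel (l a%:K - a%:K)
| tens_addr y y' : tens_rel (r (y + y') - (r y + r y'))
| tens_mulr y y' : tens_rel (r (y * y') - r y * r y')
| tens_scalr (a : K) : tens_rel (r a%:K - a%:K)
| tens_comm x y : tens_rel (l x * r y - r y * l x).

Definition tens : kalgType K := presalg tens_rel.
Definition tensl (x : A) : tens := pgen tens_rel (inl x).
Definition tensr (y : B) : tens := pgen tens_rel (inr y).
Definition tensor (x : A) (y : B) : tens := tensl x * tensr y.

Definition tens_span (P : A -> Prop) (Q : B -> Prop) (u : tens) : Prop :=
  exists s : seq (A * B), (forall p, p \in s -> P p.1 /\ Q p.2) /\
    u = \sum_(p <- s) tensor p.1 p.2.

Definition tens_lift (C : kalgType K) (f : A -> C) (g : B -> C) : tens -> C :=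
  pres_lift (S := tens_rel) (fun z => match z with inl x => f x | inr y => g y end).

Section Lift.
Variables (C : kalgType K) (f : A -> C) (g : B -> C).
Hypotheses (fh : alg_hom f) (gh : alg_hom g).
Hypothesis fg_comm : forall x y, f x * g y = g y * f x.

Lemma tens_lift_rel z : tens_rel z ->
  free_eval (fun z => match z with inl x => f x | inr y => g y end) z = 0.
Proof.
set F := (X in free_eval X).
have Fh := free_eval_hom F.
have Fl x : free_eval F (fgen K (inl x)) = f x by rewrite free_eval_gen.
have Fr y : free_eval F (fgen K (inr y)) = g y by rewrite free_eval_gen.
case=> [x x'|x x'|a|y y'|y y'|a|x y]; rewrite (alg_homB Fh).
- by rewrite (alg_homD Fh) !Fl (alg_homD fh) subrr.
- by rewrite (alg_homM Fh) !Fl (alg_homM fh) subrr.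
- by rewrite (alg_homK Fh) Fl (alg_homK fh) subrr.
- by rewrite (alg_homD Fh) !Fr (alg_homD gh) subrr.
- by rewrite (alg_homM Fh) !Fr (alg_homM gh) subrr.
- by rewrite (alg_homK Fh) Fr (alg_homK gh) subrr.
- by rewrite (alg_homM Fh _ (r y)) (alg_homM Fh _ (l x)) Fl Fr fg_comm subrr.
Qed.

Lemma tens_lift_hom : alg_hom (tens_lift f g).
Proof. exact: pres_lift_hom tens_lift_rel. Qed.

Lemma tens_liftE x y : tens_lift f g (tensor x y) = f x * g y.
Proof.
by rewrite (alg_homM tens_lift_hom) /tens_lift !(pres_lift_gen tens_lift_rel).
Qed.

End Lift.
End Tensor.

Notation "x \ox y" := (tensor x y) (at level 40, left associativity)
  : ring_scope.

Section TensorTheory.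
Variables (K : comNzRingType) (A B : kalgType K).

Lemma tensl_hom : alg_hom (@tensl K A B).
Proof.
have E u v : tens_rel (u - v) -> qclass (@tens_rel K A B) u = qclass _ v.
  by move=> h; apply/qclass_eq/ideal_gen.
split=> [x y|x y|a]; rewrite /tensl /pgen -?qclassD -?qclassM; apply: E.
- exact: tens_addl.
- exact: tens_mull.
- exact: tens_scall.
Qed.

Lemma tensr_hom : alg_hom (@tensr K A B).
Proof.
have E u v : tens_rel (u - v) -> qclass (@tens_rel K A B) u = qclass _ v.
  by move=> h; apply/qclass_eq/ideal_gen.
split=> [x y|x y|a]; rewrite /tensr /pgen -?qclassD -?qclassM; apply: E.
- exact: tens_addr.
- exact: tens_mulr.
- exact: tens_scalr.
Qed.

Lemma tenslr (x : A) (y : B) :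
  tensl B x * tensr A y = tensr A y * tensl B x.
Proof.
rewrite /tensl /tensr /pgen -!qclassM.
by apply/qclass_eq/ideal_gen/tens_comm.
Qed.

End TensorTheory.

Definition tens_flip (K : comNzRingType) (A B : kalgType K) :
  tens A B -> tens B A := tens_lift (@tensr K B A) (@tensl K B A).

Lemma tens_flipE (K : comNzRingType) (A B : kalgType K) (x : A) (y : B) :
  tens_flip (x \ox y) = y \ox x.
Proof.
pose c (x' : A) (y' : B) := esym (@tenslr K B A y' x').
by rewrite /tens_flip (tens_liftE (@tensr_hom K B A) (@tensl_hom K B A) c) c.
Qed.

(* ------------------------------------------------------------------------ *)

Definition Qq : fieldType := {fraction {poly rat}}.
Definition qvar : Qq := tofrac ('X : {poly rat}).

(* q^x.  The exponents needed are integers: in particular (mu,gamma) -      *)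
(* (lambda,lambda) is one for weights mu, gamma of V(lambda).  The value 0  *)
(* at other rationals gives V_mu = 0 when mu is not an integral weight.     *)
Definition qpow (x : rat) : Qq := if x \is a Num.int then qvar ^ numq x else 0.

Definition qint (v : Qq) (m : nat) : Qq := (v ^+ m - v ^- m) / (v - v^-1).
Definition qfact (v : Qq) (m : nat) : Qq := \prod_(1 <= k < m.+1) qint v k.
Definition qbinom (v : Qq) (m k : nat) : Qq :=
  qfact v m / (qfact v k * qfact v (m - k)).

(* A complex simple Lie algebra enters through its Cartan matrix a_ij and   *)
(* the half square lengths d_i = (alpha_i, alpha_i) / 2 of its simple roots;*)
(* these are the indecomposable Cartan matrices of finite type.             *)
Record lie_datum := LieDatum {
  rk : nat;
  cartan : 'M[int]_rk;
  symd : 'I_rk -> nat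
}.
Arguments symd : clear implicits.

Section LieDatum.
Variable g : lie_datum.

(* h^*_QQ, in coordinates with respect to the basis of simple roots.        *)
Definition hdual := 'rV[rat]_(rk g).
Definition Qlat := 'rV[int]_(rk g).

Definition hvec (b : Qlat) : hdual := map_mx intr b.
Definition sroot (i : 'I_(rk g)) : Qlat := delta_mx 0 i.

Definition hform (x y : hdual) : rat :=
  \sum_i \sum_j x 0 i * y 0 j * ((symd g i)%:R * (cartan g i j)%:~R).

Definition simple_datum : Prop :=
  [/\ (0 < rk g)%N,
      (forall i, cartan g i i = 2) /\ (forall i j, i != j -> cartan g i j <= 0),
      [/\ forall i, (0 < symd g i)%N, exists i, symd g i = 1
        & forall i j, (symd g i)%:Z * cartan g i j = (symd g j)%:Z * cartan g j i],
      forall x : hdual, x != 0 -> 0 < hform x x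
    & forall J : {set 'I_(rk g)}, J != finset.set0 -> J != [set: 'I_(rk g)]%SET ->
      exists i j, [/\ i \in J, j \notin J & cartan g i j != 0]].

Definition Qplus (b : Qlat) : bool := [forall k, 0 <= b 0 k].
Definition hQplus (x : hdual) : bool := [forall k, x 0 k \is a Num.nat].

Definition dominant_integral (x : hdual) : Prop :=
  forall i, hform x (hvec (sroot i)) / (symd g i)%:R \is a Num.nat.

Definition qform (b c : Qlat) : Qq := qpow (hform (hvec b) (hvec c)).
Definition qi (i : 'I_(rk g)) : Qq := qvar ^+ symd g i.

(* ------------------------------------------------------------------------ *)

(* The inverse of K_b is K_(-b). *)
Definition Ugens : choiceType := ('I_(rk g) + 'I_(rk g) + 'rV[int]_(rk g))%type.

Definition fE (i : 'I_(rk g)) : freealg Qq Ugens := fgen Qq (inl (inl i)).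
Definition fF (i : 'I_(rk g)) : freealg Qq Ugens := fgen Qq (inl (inr i)).
Definition fK (b : Qlat) : freealg Qq Ugens := fgen Qq (inr b).

Definition qserre (Z : 'I_(rk g) -> freealg Qq Ugens) (i j : 'I_(rk g)) :=
  let m := `|1 - cartan g i j|%N in
  \sum_(b < m.+1) ((-1) ^+ b * qbinom (qi i) m b)%:K *
    (Z i ^+ b * Z j * Z i ^+ (m - b)).

Variant Urel : freealg Qq Ugens -> Prop :=
| Urel_KK b c : Urel (fK b * fK c - fK (b + c))
| Urel_K0 : Urel (fK 0 - 1)
| Urel_KE b j : Urel (fK b * fE j * fK (- b) - (qform b (sroot j))%:K * fE j)
| Urel_KF b j : Urel (fK b * fF j * fK (- b) - (qform (- b) (sroot j))%:K * fF j)
| Urel_EF i j : Urel (fE i * fF j - fF j * fE i -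
    ((i == j)%:R / (qi i - (qi i)^-1))%:K * (fK (sroot i) - fK (- sroot i)))
| Urel_serreE i j : i != j -> Urel (qserre fE i j)
| Urel_serreF i j : i != j -> Urel (qserre fF i j).

Definition Uq : kalgType Qq := presalg Urel.
Definition UE i : Uq := pgen Urel (inl (inl i)).
Definition UF i : Uq := pgen Urel (inl (inr i)).
Definition UK (b : Qlat) : Uq := pgen Urel (inr b).

Definition Udeg (b : Qlat) (x : Uq) : Prop :=
  forall c : Qlat, UK c * x * UK (- c) = (qform b c)%:K * x.

Definition Unplus : Uq -> Prop := subalg (fun x => exists i, x = UE i).
Definition Unminus : Uq -> Prop := subalg (fun x => exists i, x = UF i).
Definition Ubplus : Uq -> Prop :=
  subalg (fun x => Unplus x \/ exists b, x = UK b).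
Definition Ubminus : Uq -> Prop :=
  subalg (fun x => Unminus x \/ exists b, x = UK b).

Local Notation UU := (tens Uq Uq).

Definition is_coproduct (Delta : Uq -> UU) : Prop :=
  [/\ alg_hom Delta,
      forall b, Delta (UK b) = UK b \ox UK b,
      forall i, Delta (UE i) = UE i \ox UK (sroot i) + 1 \ox UE i
    & forall i, Delta (UF i) = UF i \ox 1 + UK (- sroot i) \ox UF i].

Definition is_Psi (Psi : UU -> UU) : Prop :=
  [/\ alg_hom Psi,
      forall b, Psi (UK b \ox 1) = UK b \ox 1 /\ Psi (1 \ox UK b) = 1 \ox UK b,
      forall i, Psi (UE i \ox 1) = UE i \ox UK (- sroot i) /\
                Psi (UF i \ox 1) = UF i \ox UK (sroot i)
    & forall i, Psi (1 \ox UE i) = UK (- sroot i) \ox UE i /\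
                Psi (1 \ox UF i) = UK (sroot i) \ox UF i].

Definition leg1_deg (b : Qlat) : UU -> Prop := tens_span (Udeg b) (fun _ => True).
Definition leg2_deg (b : Qlat) : UU -> Prop := tens_span (fun _ => True) (Udeg b).

(* c is the family of homogeneous components of u for the grading H.        *)
Definition components (A : kalgType Qq) (H : Qlat -> A -> Prop) (u : A)
    (c : Qlat -> A) : Prop :=
  (forall b, H b (c b)) /\
  exists s : seq Qlat,
    [/\ uniq s, forall b, b \notin s -> c b = 0 & u = \sum_(b <- s) c b].

Definition Qinterval (b : Qlat) : set Qlat :=
  [set nu | Qplus nu && Qplus (b - nu)]%classic.

Definition is_Rplus (Delta : Uq -> UU) (Psi : UU -> UU) (R : Qlat -> UU) : Prop :=
  let DeltaPsiop x := tens_flip (Psi (Delta x)) in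
  [/\ forall nu, Qplus nu ->
        tens_span (fun x => Unplus x /\ Udeg nu x)
                  (fun y => Unminus y /\ Udeg (- nu) y) (R nu),
      R 0 = 1,
      forall b x, Qplus b -> Ubplus x ->
        forall c c', components leg1_deg (Delta x) c ->
          components leg1_deg (DeltaPsiop x) c' ->
        \sum_(nu \in Qinterval b) (R nu * c (b - nu) - c' (b - nu) * R nu) = 0
    & forall b y, Qplus b -> Ubminus y ->
        forall c c', components leg2_deg (Delta y) c ->
          components leg2_deg (DeltaPsiop y) c' ->
        \sum_(nu \in Qinterval b) (R nu * c (nu - b) - c' (nu - b) * R nu) = 0].

(* ------------------------------------------------------------------------ *)

Section Module.
Variables (V : vectType Qq) (rho : Uq -> 'End(V)).

Definition wtvec (mu : hdual) (v : V) : Prop :=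
  forall b : Qlat, rho (UK b) v = qpow (hform mu (hvec b)) *: v.

Definition is_weight (mu : hdual) : Prop := exists2 v, v != 0 & wtvec mu v.

Definition is_rep : Prop :=
  [/\ rho 1 = \1%VF, forall x y, rho (x * y) = (rho x \o rho y)%VF,
      forall x y, rho (x + y) = rho x + rho y
    & forall a : Qq, rho a%:K = a *: \1%VF].

Definition irreducible_rep : Prop :=
  (fullv : {vspace V}) != 0%VS /\
  forall W : {vspace V}, (forall x, (rho x @: W <= W)%VS) ->
    W = 0%VS \/ W = fullv.

Definition highest_weight (lam : hdual) : Prop :=
  exists v, [/\ v != 0, wtvec lam v & forall i, rho (UE i) v = 0].

(* Type 1 is part of this: K_b acts on V_mu by q^(mu,b), without signs.     *)
Definition irrep_hw (lam : hdual) : Prop :=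
  [/\ is_rep, irreducible_rep & highest_weight lam].

Variables (n : nat) (e : n.-tuple V) (wt : 'I_n -> hdual).

Definition weight_basis : Prop :=
  basis_of fullv e /\ forall i, wtvec (wt i) (tnth e i).

Definition rho_mx (x : Uq) : 'M[Qq]_n :=
  \matrix_(i, j) coord e i (rho x (tnth e j)).

Definition rho2_mx : UU -> 'M[Qq]_(n * n) :=
  tens_lift (C := 'M[Qq]_(n * n))
    (fun x => rho_mx x *t 1%:M) (fun y => 1%:M *t rho_mx y).

Definition Dmx (lam : hdual) : 'M[Qq]_(n * n) :=
  \sum_i \sum_j qpow (hform (wt i) (wt j) - hform lam lam) *:
    (delta_mx i i *t delta_mx j j).

(* The sum has finite support: R_nu shifts weights by nu in the first leg.   *)
Definition Rmx (lam : hdual) (R : Qlat -> UU) : 'M[Qq]_(n * n) :=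
  Dmx lam *m \sum_(nu \in [set nu : Qlat | Qplus nu]%classic) rho2_mx (R nu).

End Module.

(* ------------------------------------------------------------------------ *)

(* A matrix T over A stands for \sum_(i,j) E_ij (x) T_ij in End(V) (x) A,   *)
(* where E_ij are the matrix units of a basis of weight vectors of weights  *)
(* wt; E_ij has degree wt i - wt j, so that the E_ij with wt i - wt j in Q+ *)
(* (resp. Q-) are the chosen basis X_k of the sum of the End(V)_b.          *)
Section RTT.
Variables (n : nat) (wt : 'I_n -> hdual).

Definition degpart (A : kalgType Qq) (b : Qlat) (T : 'M[A]_n) : 'M[A]_n :=
  \matrix_(i, j) if wt i - wt j == hvec b then T i j else 0.

Variable R : 'M[Qq]_(n * n).

Definition Lgens : choiceType :=
  ({p : 'I_n * 'I_n | hQplus (wt p.1 - wt p.2)} +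
   {p : 'I_n * 'I_n | hQplus (wt p.2 - wt p.1)})%type.

(* s = true is the sign +, s = false is the sign -.                         *)
Definition Lfree (s : bool) : 'M[freealg Qq Lgens]_n :=
  \matrix_(i, j)
    if s then oapp (fun p => fgen Qq (inl p)) 0 (insub (i, j))
    else oapp (fun p => fgen Qq (inr p)) 0 (insub (i, j)).

Definition URcomm (s t : bool) : 'M[freealg Qq Lgens]_(n * n) :=
  let Rf := map_mx (fun a : Qq => a%:K : freealg Qq Lgens) R in
  let L1 := Lfree s *t 1%:M in
  let L2 := 1%:M *t Lfree t in
  Rf *m L1 *m L2 - L2 *m L1 *m Rf.

Variant URrel : freealg Qq Lgens -> Prop :=
| URrel_inv s i j :
    URrel ((degpart 0 (Lfree s) *m degpart 0 (Lfree (~~ s)) - 1%:M) i j)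
| URrel_pm i j : URrel (URcomm true false i j)
| URrel_ss s i j : URrel (URcomm s s i j).

Definition UR : kalgType Qq := presalg URrel.

Definition Lmx (s : bool) : 'M[UR]_n := map_mx (qclass URrel) (Lfree s).

Definition is_coproductR (Delta : UR -> tens UR UR) : Prop :=
  alg_hom Delta /\
  forall s, map_mx Delta (Lmx s) =
            map_mx (@tensl _ UR UR) (Lmx s) *m map_mx (@tensr _ UR UR) (Lmx s).

Definition is_counitR (eps : UR -> Qq^o) : Prop :=
  alg_hom eps /\ forall s, map_mx eps (Lmx s) = 1%:M.

Definition is_grading (A : kalgType Qq) (G : Qlat -> A -> Prop) : Prop :=
  [/\ forall b, [/\ G b 0, forall x y, G b x -> G b y -> G b (x + y)
                  & forall (a : Qq) x, G b x -> G b (a%:K * x)],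
      G 0 1,
      forall b c x y, G b x -> G c y -> G (b + c) (x * y),
      forall x, exists c, components G x c
    & forall x c c', components G x c -> components G x c' -> c =1 c'].

Definition is_gradingR (G : Qlat -> UR -> Prop) : Prop :=
  is_grading G /\ forall s b i j, G b (degpart b (Lmx s) i j).

(* L_mu, the block on V_mu of the degree 0 part of L^+.                     *)
Definition Lblock (mu : hdual) : 'M[UR]_n :=
  \matrix_(i, j)
    if (wt i == mu) && (wt j == mu) then degpart 0 (Lmx true) i j else 0.

Definition id_block (mu : hdual) (l : UR) : 'M[UR]_n :=
  \matrix_(i, j) if (i == j) && (wt i == mu) then l else 0.

Definition grouplike (Delta : UR -> tens UR UR) (eps : UR -> Qq^o) (l : UR) :
  Prop := Delta l = l \ox l /\ eps l = 1.

End RTT.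
End LieDatum.

(* Main.v *)
Require Import Defs.
From mathcomp Require Import all_boot all_order all_algebra.
From mathcomp Require Import mxtens boolp classical_sets fsbigop monalg.
From mathcomp Require Import ring.

(* Write L0 for the degree 0 part of L+.  In the bidegrees where only the      *)
(* diagonal part D of R contributes, the RTT relations say that the entries of *)
(* L0 commute and that the entries of L+ and L- q-commute with the diagonal    *)
(* ones.  In bidegree (alpha_a, -alpha_a) the relation for two copies of L+    *)
(* involves R only through its term c E_a (x) F_a, with c <> 0 unless F_a = 0  *)
(* on V, and becomes (E_a L0)_1 (F_a L0)_2 = (L0 F_a)_2 (L0 E_a)_1.  As E_a    *)
(* is a nonzero matrix of scalars, this gives L0 F_a = z_a F_a L0 for a single *)
(* element z_a, and the z_a commute.  L0 is one element on the                 *)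
(* one-dimensional highest weight space and V is generated from it by the F_a, *)
(* so L0 acts on V_mu as that element times the product of the z_a whose       *)
(* exponents are the coordinates of lambda - mu.                               *)

(** The engine is triangularity. [L+] has degrees in the positive root cone, [L-] in its negative,
    [R] has bidegrees (nu, -nu) with nu in the cone, and the cone is pointed ([hQplus_pointed]).
    Fixing a bidegree in an RTT relation therefore leaves very few terms: only D in [RLL_pm] and
    [RLL_pp_diag], only the simple root term in [RLL_pp_simple].

    The constant c of that term is never computed. [Rplus_sroot] shows that it can be taken nonzero
    unless F_a is 0 on V: otherwise the intertwining relation for E_a would force E_a = 0 or K_a =
    K_a^-1 on V, and either makes F_a vanish. [L0_F_scale] then produces z_a, and [L0_eigen] carries
    the action of [L0] down from the highest weight line, using [Fspan_full] and [hw_line].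

    Once [L0] is known to be scalar on each weight space, the element attached to mu is the diagonal
    entry of [L+] at any basis vector of weight mu. Its coproduct is a sum over k of entries (i,k)
    and (k,i); triangularity forces k to have weight mu, and diagonality then forces k = i. Its
    conjugation action on the entries of [L+] and [L-] is a quotient of two coefficients of D
    ([L_conj]), and [graded_conj] extends the rule to every homogeneous element. *)

Set Implicit Arguments.
Unset Strict Implicit.
Unset Printing Implicit Defensive.

Import Order.TTheory GRing.Theory Num.Theory.
Local Open Scope ring_scope.

(** * Powers of q and the root lattice *)

Lemma qvar_neq0 : qvar != 0.
Proof. by rewrite /qvar tofrac_eq0 polyX_eq0. Qed.

Lemma qvarX_eq1 (k : nat) : qvar ^+ k = 1 -> k = 0%N.
Proof.
rewrite /qvar -tofracXn -tofrac1 => /eqP; rewrite tofrac_eq => /eqP h.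
by have := size_polyXn rat k; rewrite h size_poly1 => -[].
Qed.

Lemma qvarXz_eq1 (z : int) : qvar ^ z = 1 -> z = 0.
Proof.
case: z => k; first by move=> /qvarX_eq1 ->.
by rewrite NegzE => h; have /invr_inj/qvarX_eq1 : (qvar ^+ k.+1)^-1 = 1^-1
  by rewrite invr1.
Qed.

Lemma qpow_int (z : int) : qpow z%:~R = qvar ^ z.
Proof. by rewrite /qpow intr_int numq_int. Qed.

Lemma qpow_neq0 (x : rat) : (qpow x != 0) = (x \is a Num.int).
Proof.
rewrite /qpow; case: ifP => _; last by rewrite eqxx.
by rewrite expfz_neq0 // qvar_neq0.
Qed.

Lemma qpowD (x y : rat) : x \is a Num.int -> y \is a Num.int ->
  qpow (x + y) = qpow x * qpow y.
Proof.
by move=> /intrP[a ->] /intrP[b ->]; rewrite -intrD !qpow_int expfzDr ?qvar_neq0.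
Qed.

Lemma qpow0 : qpow 0 = 1.
Proof. exact: (qpow_int 0). Qed.

(** [qpow] is nonzero exactly on the integers, so integrality passes from [x] to [y]; on integers,
    injectivity says that q is not a root of unity. *)
Lemma qpow_inj (x y : rat) : x \is a Num.int -> qpow x = qpow y -> x = y.
Proof.
move=> hx exy; have hy : y \is a Num.int by rewrite -qpow_neq0 -exy qpow_neq0.
move: hx hy exy => /intrP[a ->] /intrP[b ->]; rewrite !qpow_int => exy.
have /qvarXz_eq1/subr0_eq-> // : qvar ^ (a - b) = 1.
by rewrite expfzDr ?qvar_neq0 // exy -expfzDr ?qvar_neq0 // subrr.
Qed.

Section Lattice.
Variable g : lie_datum.
Implicit Types (x y z : hdual g) (b c : Qlat g).

Lemma hvecD b c : hvec (b + c) = hvec b + hvec c.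
Proof. exact: map_mxD. Qed.
Lemma hvecN b : hvec (- b) = - hvec b.
Proof. exact: map_mxN. Qed.
Lemma hvec0 : hvec (0 : Qlat g) = 0.
Proof. exact: map_mx0. Qed.
Lemma hvec_inj : injective (@hvec g).
Proof.
move=> b c /matrixP h; apply/matrixP => i j.
by have := h i j; rewrite !mxE => /intr_inj.
Qed.

Lemma hvec_Qplus b : hQplus (hvec b) = Qplus b.
Proof.
apply: eq_forallb => k; rewrite mxE natrEint intr_int /=.
by rewrite -[0]/(0%:~R) ler_int.
Qed.

Lemma hQplusP x : reflect (exists2 b, Qplus b & x = hvec b) (hQplus x).
Proof.
apply: (iffP idP) => [hx|[b hb ->]]; last by rewrite hvec_Qplus.
have hxb : x = hvec (\row_k numq (x 0 k)).
  apply/rowP => k; rewrite !mxE.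
  have /intrP[a ->] : x 0 k \is a Num.int by apply: intr_nat; apply: (forallP hx).
  by rewrite numq_int.
by exists (\row_k numq (x 0 k)); rewrite -?hvec_Qplus -hxb.
Qed.

Lemma hQplus0 : hQplus (0 : hdual g).
Proof. by apply/forallP => k; rewrite mxE nat_num0. Qed.

Lemma hQplusD x y : hQplus x -> hQplus y -> hQplus (x + y).
Proof.
by move=> /forallP hx /forallP hy; apply/forallP => k; rewrite mxE rpredD.
Qed.

Lemma hQplus_pointed x : hQplus x -> hQplus (- x) -> x = 0.
Proof.
move=> /forallP hx /forallP hy; apply/rowP => k; apply/eqP.
have := hy k; rewrite mxE => /natr_ge0; rewrite oppr_ge0 => x0.
by rewrite eq_le mxE x0 natr_ge0 ?hx.
Qed.

Lemma hQplus_sum0 x y : hQplus x -> hQplus y -> x + y = 0 -> x = 0 /\ y = 0.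
Proof.
move=> hx hy /eqP; rewrite addr_eq0 => /eqP exy.
have y0 : y = 0 by apply: hQplus_pointed; rewrite // -exy.
by split=> //; rewrite exy y0 oppr0.
Qed.

Lemma sroot_Qplus i : Qplus (sroot i : Qlat g).
Proof. by apply/forallP => k; rewrite mxE; case: andb. Qed.

Lemma hvec_sroot i : hvec (sroot i : Qlat g) = delta_mx 0 i.
Proof. by apply/rowP => k; rewrite !mxE; case: andb. Qed.

Lemma sroot_neq0 i : (sroot i : Qlat g) != 0.
Proof. by apply/eqP => /rowP/(_ i); rewrite !mxE !eqxx. Qed.

Lemma sroot_inj : injective (@sroot g).
Proof.
move=> i j /rowP/(_ i); rewrite !mxE !eqxx /= => /eqP.
by case: (i =P j).
Qed.

(** A simple root has a single nonzero coordinate, equal to 1, so it is indecomposable in the cone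
    of vectors with natural coordinates. *)
Lemma sroot_split i x y : hQplus x -> hQplus y -> x + y = hvec (sroot i) ->
  x = 0 \/ x = hvec (sroot i).
Proof.
rewrite hvec_sroot => /forallP hx /forallP hy exy.
have e k : x 0 k + y 0 k = (k == i)%:R by have /rowP/(_ k) := exy; rewrite !mxE.
have z k : k != i -> x 0 k = 0.
  move=> ki; have := e k; rewrite (negbTE ki) => /eqP.
  by rewrite paddr_eq0 ?natr_ge0 // => /andP[/eqP].
have: x 0 i + y 0 i = 1 by rewrite e eqxx.
have /natrP[[|[|a]] ha] := hx i.
- by move=> _; left; apply/rowP => k; rewrite mxE; case: (eqVneq k i) => [->|/z].
- move=> _; right; apply/rowP => k; rewrite mxE /=.
  by case: (eqVneq k i) => [->|/z].
have /natrP[b hb] := hy i; rewrite ha hb -natrD => /eqP.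
by rewrite -[1]/(1%:R) eqr_nat addSn addSn.
Qed.

Lemma hformDl x y z : hform (x + y) z = hform x z + hform y z.
Proof.
rewrite /hform -big_split; apply: eq_bigr => i _ /=.
by rewrite -big_split; apply: eq_bigr => j _; rewrite /= mxE !mulrDl.
Qed.
Lemma hformDr x y z : hform x (y + z) = hform x y + hform x z.
Proof.
rewrite /hform -big_split; apply: eq_bigr => i _ /=.
by rewrite -big_split; apply: eq_bigr => j _; rewrite /= mxE mulrDr !mulrDl.
Qed.
Lemma hformNl x y : hform (- x) y = - hform x y.
Proof.
apply: (addIr (hform x y)); rewrite addNr -hformDl addNr.
by rewrite /hform big1 // => i _; rewrite big1 // => j _; rewrite mxE !mul0r.
Qed.
Lemma hformNr x y : hform x (- y) = - hform x y.
Proof.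
apply: (addIr (hform x y)); rewrite addNr -hformDr addNr.
by rewrite /hform big1 // => i _; rewrite big1 // => j _; rewrite mxE mulr0 mul0r.
Qed.
Lemma hform0l y : hform 0 y = 0.
Proof. by apply: (addIr (hform 0 y)); rewrite -hformDl !add0r. Qed.
Lemma hform0r y : hform y 0 = 0.
Proof. by apply: (addIr (hform y 0)); rewrite -hformDr !add0r. Qed.

Lemma hformZr (a : rat) x y : hform x (a *: y) = a * hform x y.
Proof.
rewrite /hform big_distrr; apply: eq_bigr => i _ /=.
by rewrite big_distrr; apply: eq_bigr => j _ /=; rewrite mxE; ring.
Qed.

Lemma hform_sum_sroot x y :
  hform x y = \sum_k y 0 k * hform x (hvec (sroot k)).
Proof.
rewrite {1}(row_sum_delta y).
rewrite (big_morph (hform x) (hformDr x) (hform0r x)).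
by apply: eq_bigr => k _; rewrite hformZr hvec_sroot.
Qed.

Hypothesis Hg : simple_datum g.

Lemma hformC x y : hform x y = hform y x.
Proof.
case: Hg => _ _ [_ _ sym] _ _; rewrite /hform exchange_big /=.
apply: eq_bigr => i _; apply: eq_bigr => j _.
have := sym j i => /(congr1 (fun z : int => z%:~R : rat)); rewrite !intrM => ->.
by rewrite [x 0 _ * _]mulrC.
Qed.

(** Positive definiteness gives nondegeneracy. This is how weights are recovered from the
    eigenvalues of the K_b. *)
Lemma hform_nondeg x : (forall b, hform x (hvec b) = 0) -> x = 0.
Proof.
case: Hg => _ _ _ pos _ h; case: (eqVneq x 0) => [//|/pos].
rewrite hform_sum_sroot big1 ?ltxx // => k _; by rewrite h mulr0.
Qed.

Lemma hform_int b c : hform (hvec b) (hvec c) \is a Num.int.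
Proof.
rewrite /hform; apply: rpred_sum => i _; apply: rpred_sum => j _.
by rewrite !mxE -intrM -[(symd g i)%:R]/((symd g i)%:Z%:~R) -!intrM intr_int.
Qed.

Lemma dominant_hform_int x b : dominant_integral x -> hform x (hvec b) \is a Num.int.
Proof.
move=> hx; rewrite hform_sum_sroot; apply: rpred_sum => k _.
rewrite mxE; apply: rpredM; first exact: intr_int.
case: Hg => _ _ [pos _ _] _ _; have := hx k => /intr_nat h.
rewrite -[hform _ _](@divfK _ (symd g k)%:R) ?pnatr_eq0 -?lt0n //.
by apply: rpredM => //; apply: intr_nat; apply: natr_nat.
Qed.

End Lattice.

(** * The quantum group and its highest weight modules *)

Section AlgebraMaps.
Variables (K : comNzRingType) (A B : kalgType K) (f : A -> B).
Hypothesis fh : alg_hom f.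

Lemma alg_hom1 : f 1 = 1.
Proof. by rewrite -(@kin1 K A) (alg_homK fh) kin1. Qed.

Lemma alg_hom_sum (I : Type) (s : seq I) (P : pred I) (F : I -> A) :
  f (\sum_(i <- s | P i) F i) = \sum_(i <- s | P i) f (F i).
Proof. exact: (big_morph f (alg_homD fh) (alg_hom0 fh)). Qed.

Lemma map_alg_homM m n p (M : 'M[A]_(m, n)) (N : 'M[A]_(n, p)) :
  map_mx f (M *m N) = map_mx f M *m map_mx f N.
Proof.
apply/matrixP => i j; rewrite !mxE alg_hom_sum.
by apply: eq_bigr => k _; rewrite (alg_homM fh) !mxE.
Qed.

End AlgebraMaps.

Section Presented.
Variables (K : comNzRingType) (X : choiceType).

Lemma freealg_ind (P : freealg K X -> Prop) :
  (forall x, P (fgen K x)) -> (forall a : K, P a%:K) ->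
  (forall u v, P u -> P v -> P (u + v)) ->
  (forall u v, P u -> P v -> P (u * v)) -> forall u, P u.
Proof.
move=> Pg Pk Pa Pm u; rewrite (monalgE u).
elim/big_ind: _ => [||m _]; [by rewrite -(@kin0 K (freealg K X)) | exact: Pa |].
move: (mcoeff m u) => a; case: m => s; elim: s a => [|x s IH] a.
  have -> : FMonom [::] = mone :> {fmonom X} by rewrite -fmoneE.
  exact: Pk.
have -> : mkmalgU (FMonom (x :: s)) a = fgen K x * mkmalgU (FMonom s) a
    :> freealg K X.
  rewrite freealg_mulE fgen.unlock fgmulUU mul1r; congr mkmalgU.
  by apply/eqP; rewrite fmP fmM fmU.
by apply: Pm.
Qed.

Variable S : freealg K X -> Prop.

Lemma presalg_ind (P : presalg S -> Prop) :
  (forall x, P (pgen S x)) -> (forall a : K, P a%:K) ->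
  (forall u v, P u -> P v -> P (u + v)) ->
  (forall u v, P u -> P v -> P (u * v)) -> forall u, P u.
Proof.
move=> Pg Pk Pa Pm; apply: qclassP; apply: freealg_ind => // [u v|u v] hu hv.
  by rewrite qclassD; apply: Pa.
by rewrite qclassM; apply: Pm.
Qed.

Lemma pres_rel u v : S (u - v) -> qclass S u = qclass S v.
Proof. by move=> h; apply/qclass_eq/ideal_gen. Qed.

End Presented.

Section QuantumGroup.
Variable g : lie_datum.
Hypothesis Hg : simple_datum g.

Lemma UKD b c : UK b * UK c = UK (b + c) :> Uq g.
Proof. by rewrite /UK /pgen -qclassM; apply/pres_rel/Urel_KK. Qed.
Lemma UK0 : UK 0 = 1 :> Uq g.
Proof. by rewrite /UK /pgen; apply/pres_rel/Urel_K0. Qed.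
Lemma UKN b : UK (- b) * UK b = 1 :> Uq g.
Proof. by rewrite UKD addNr UK0. Qed.
Lemma UKNr b : UK b * UK (- b) = 1 :> Uq g.
Proof. by rewrite UKD subrr UK0. Qed.

Lemma Udeg_comm b c (x : Uq g) : Udeg b x -> UK c * x = (qform b c)%:K * (x * UK c).
Proof. by move=> h; rewrite mulrA -h -mulrA UKN mulr1. Qed.

Lemma UE_deg j : Udeg (sroot j) (UE j : Uq g).
Proof.
move=> c; have h := pres_rel (Urel_KE c j); rewrite !qclassM in h.
by apply: etrans h _; rewrite /qform hformC.
Qed.

Lemma UF_deg j : Udeg (- sroot j) (UF j : Uq g).
Proof.
move=> c; have h := pres_rel (Urel_KF c j); rewrite !qclassM in h.
by apply: etrans h _; rewrite /qform !hvecN hformNl hformNl hformC.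
Qed.

Lemma UEF i j : UE i * UF j - UF j * UE i =
  ((i == j)%:R / (qi i - (qi i)^-1))%:K * (UK (sroot i) - UK (- sroot i)) :> Uq g.
Proof.
have hom := qclass_hom (@Urel g).
have h := pres_rel (Urel_EF i j).
by rewrite (alg_homB hom) !qclassM (alg_homB hom) in h; exact: h.
Qed.

Lemma Uq_ind (P : Uq g -> Prop) :
  (forall i, P (UE i)) -> (forall i, P (UF i)) -> (forall b, P (UK b)) ->
  (forall a : Qq, P a%:K) -> (forall u v, P u -> P v -> P (u + v)) ->
  (forall u v, P u -> P v -> P (u * v)) -> forall u, P u.
Proof. by move=> PE PF PK *; apply: presalg_ind => // -[[]|]. Qed.

Section Module.
Variables (V : vectType Qq) (rho : Uq g -> 'End(V)) (lam : hdual g).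
Hypothesis Hrep : is_rep rho.

Lemma rho1 v : rho 1 v = v.
Proof. by have [h _ _ _] := Hrep; rewrite h; exact: id_lfunE. Qed.
Lemma rhoM x y v : rho (x * y) v = rho x (rho y v).
Proof. by case: Hrep => _ -> _ _; rewrite comp_lfunE. Qed.
Lemma rhoD x y v : rho (x + y) v = rho x v + rho y v.
Proof. by case: Hrep => _ _ -> _; rewrite add_lfunE. Qed.
Lemma rhoK (a : Qq) v : rho a%:K v = a *: v.
Proof. by case: Hrep => _ _ _ ->; rewrite scale_lfunE id_lfunE. Qed.
Lemma rho_B x y v : rho (x - y) v = rho x v - rho y v.
Proof. by apply/eqP; rewrite eq_sym subr_eq -rhoD subrK. Qed.

(** By finite dimension there is a subspace of maximal dimension among those contained in [P];
    adding the line of a vector satisfying [P] cannot enlarge it. *)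
Lemma submod_vspace (P : V -> Prop) : P 0 -> (forall u v, P u -> P v -> P (u + v)) ->
  (forall (a : Qq) u, P u -> P (a *: u)) ->
  exists W : {vspace V}, forall v, v \in W <-> P v.
Proof.
move=> P0 PD PZ.
pose ok d := `[< exists W : {vspace V}, \dim W = d /\ forall v, v \in W -> P v >].
have ok0 : exists d, ok d.
  exists 0%N; apply/asboolP; exists 0%VS; rewrite dimv0; split=> // v.
  by rewrite memv0 => /eqP->.
have okb d : ok d -> (d <= \dim {:V})%N.
  by move=> /asboolP[W [<- _]]; apply/dimvS/subvf.
case: (ex_maxnP ok0 okb) => d /asboolP[W [dW PW]] dmax.
exists W => v; split; first exact: PW.
move=> Pv; have /dmax : ok (\dim (W + <[v]>)%VS).
  apply/asboolP; exists (W + <[v]>)%VS; split=> // u /memv_addP[w /PW Pw [x]].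
  by move=> /vlineP[a ->] ->; apply/PD/PZ.
rewrite -dW => h; have /eqP-> : W == (W + <[v]>)%VS by rewrite eqEdim addvSl.
by rewrite -{1}[v]add0r memv_add ?mem0v ?memv_line.
Qed.

Hypothesis Hirr : irreducible_rep rho.

(** Irreducibility as an induction principle: the vectors satisfying [P] form a nonzero
    submodule. *)
Lemma irrep_ind (P : V -> Prop) (v0 : V) : v0 != 0 -> P v0 ->
  (forall u v, P u -> P v -> P (u + v)) ->
  (forall x u, P u -> P (rho x u)) -> forall v, P v.
Proof.
move=> v0n Pv0 PD Prho.
have PZ (a : Qq) u : P u -> P (a *: u) by rewrite -rhoK; apply: Prho.
have P0 : P 0 by rewrite -(scale0r v0); apply: PZ.
have [W hW] := submod_vspace P0 PD PZ.
move=> v; have [_ hirr] := Hirr; have [x|W0|Wf] := hirr W.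
- by apply/subvP => _ /memv_imgP[u /hW Pu ->]; apply/hW/Prho.
- by case/negP: v0n; rewrite -memv0 -W0; apply/hW.
- by apply/hW; rewrite Wf memvf.
Qed.

Variable v0 : V.
Hypotheses (v0n : v0 != 0) (v0w : wtvec rho lam v0) (Ev0 : forall i, rho (UE i) v0 = 0).

Inductive Fspan : V -> Prop :=
| Fspan_hw : Fspan v0
| Fspan_F i u : Fspan u -> Fspan (rho (UF i) u)
| Fspan_add u v : Fspan u -> Fspan v -> Fspan (u + v)
| Fspan_scale (a : Qq) u : Fspan u -> Fspan (a *: u).

(** The span of the F-monomials applied to [v0] is a submodule: the K_b rescale these monomials, and
    moving E_i to the right past F_j leaves only K-terms until E_i reaches [v0] and kills it. *)
Lemma Fspan_full v : Fspan v.
Proof.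
have F0 : Fspan 0 by rewrite -(scale0r v0); apply/Fspan_scale/Fspan_hw.
have FK b u : Fspan u -> Fspan (rho (UK b) u).
  elim=> {u} [|i u _ IH|u v' _ hu _ hv|a u _ hu].
  - by rewrite v0w; apply/Fspan_scale/Fspan_hw.
  - rewrite -rhoM (Udeg_comm b (UF_deg i)) rhoM rhoK rhoM.
    by apply/Fspan_scale/Fspan_F.
  - by rewrite linearD; apply: Fspan_add.
  - by rewrite linearZ; apply: Fspan_scale.
have FE i u : Fspan u -> Fspan (rho (UE i) u).
  elim=> {u} [|j u hu IH|u v' _ hu _ hv|a u _ hu].
  - by rewrite Ev0.
  - rewrite -rhoM -[UE i * UF j](subrK (UF j * UE i)) UEF rhoD rhoM rhoK.
    apply: Fspan_add; last by rewrite rhoM; apply: Fspan_F.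
    apply: Fspan_scale; rewrite rho_B -scaleN1r.
    by apply: Fspan_add; last apply: Fspan_scale; apply: FK.
  - by rewrite linearD; apply: Fspan_add.
  - by rewrite linearZ; apply: Fspan_scale.
apply: (irrep_ind v0n Fspan_hw Fspan_add) => x.
elim/Uq_ind: x => [i|i|b|a|x y hx hy|x y hx hy] u hu.
- exact: FE.
- exact: Fspan_F.
- exact: FK.
- by rewrite rhoK; apply: Fspan_scale.
- by rewrite rhoD; apply: Fspan_add; [apply: hx|apply: hy].
- by rewrite rhoM; apply/hx/hy.
Qed.

End Module.

End QuantumGroup.

Lemma mx_kinE n (a : Qq) (M : 'M[Qq]_n) : a%:K * M = a *: M.
Proof. exact: mul_scalar_mx. Qed.

(** * Matrices of the quantum group in a basis of weight vectors *)

Section WeightBasis.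
Variable g : lie_datum.
Hypothesis Hg : simple_datum g.
Variables (V : vectType Qq) (rho : Uq g -> 'End(V)).
Hypothesis Hrep : is_rep rho.
Variables (n : nat) (e : n.-tuple V) (wt : 'I_n -> hdual g).
Hypothesis He : weight_basis rho e wt.
Implicit Types (x y : Uq g) (u v : V) (b c : Qlat g).

Local Notation rmx := (rho_mx rho e).

Definition coordv (v : V) : 'cV[Qq]_n := \col_i coord e i v.

Lemma coordvD u v : coordv (u + v) = coordv u + coordv v.
Proof. by apply/colP => i; rewrite !mxE linearD. Qed.
Lemma coordvZ (a : Qq) v : coordv (a *: v) = a *: coordv v.
Proof. by apply/colP => i; rewrite !mxE linearZ. Qed.

Lemma coordv_sum v : v = \sum_i coordv v i 0 *: tnth e i.
Proof.
have [b _] := He; rewrite {1}(coord_basis b (memvf v)).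
by apply: eq_bigr => i _; rewrite mxE (tnth_nth 0).
Qed.

Lemma coordv_inj v : coordv v = 0 -> v = 0.
Proof.
move=> h; rewrite (coordv_sum v) big1 // => i _.
by rewrite h mxE scale0r.
Qed.

Lemma coordv_e i : coordv (tnth e i) = delta_mx i 0.
Proof.
have [b _] := He; apply/colP => j; rewrite !mxE (tnth_nth 0) coord_free.
  by rewrite eqxx andbT eq_sym.
exact: basis_free b.
Qed.

Lemma e_neq0 i : tnth e i != 0.
Proof.
apply/eqP => h; have /colP/(_ i) := coordv_e i.
by rewrite h !mxE linear0 !eqxx => /esym/eqP; rewrite oner_eq0.
Qed.

Lemma coordv_rho x v : coordv (rho x v) = rmx x *m coordv v.
Proof.
apply/colP => i; rewrite {1}(coordv_sum v) linear_sum !mxE linear_sum.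
by apply: eq_bigr => j _; rewrite !mxE !linearZ /= mulrC.
Qed.

Lemma rho_mxE x j : coordv (rho x (tnth e j)) = col j (rmx x).
Proof. by rewrite coordv_rho coordv_e -colE. Qed.

Lemma mx_coordP (M N : 'M[Qq]_n) :
  (forall v, M *m coordv v = N *m coordv v) -> M = N.
Proof.
move=> h; apply/matrixP => i j; have := h (tnth e j).
by rewrite coordv_e -!colE => /colP/(_ i); rewrite !mxE.
Qed.

Lemma rho_mx_hom : @alg_hom Qq (Uq g) 'M[Qq]_n rmx.
Proof.
split=> [x y|x y|a]; apply: mx_coordP => v.
- by rewrite mulmxDl -!coordv_rho (rhoD Hrep) coordvD.
- by rewrite -[rmx x * rmx y]/(rmx x *m rmx y) -mulmxA -!coordv_rho (rhoM Hrep).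
- by rewrite -coordv_rho (rhoK Hrep) coordvZ mul_scalar_mx.
Qed.

(** K_b is invertible, whereas a non-integral pairing would make it act on [v] by the default value
    0 of [qpow]. *)
Lemma wtvec_int mu v b : v != 0 -> wtvec rho mu v -> hform mu (hvec b) \is a Num.int.
Proof.
move=> v0 hv; rewrite -qpow_neq0; apply/eqP => h.
case/eqP: v0; rewrite -(rho1 Hrep v) -(UKN b) (rhoM Hrep) hv h scale0r.
exact: linear0.
Qed.

Lemma wt_int i b : hform (wt i) (hvec b) \is a Num.int.
Proof. by have [_ h] := He; apply: wtvec_int (e_neq0 i) (h i). Qed.

Lemma rho_mx_UK b i j :
  rmx (UK b) i j = (i == j)%:R * qpow (hform (wt i) (hvec b)).
Proof.
have [_ h] := He; have := rho_mxE (UK b) j; rewrite h coordvZ coordv_e.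
move=> /colP/(_ i); rewrite !mxE eqxx andbT => <-.
by case: eqP => [->|_]; rewrite ?mulr1 ?mul1r // mulr0 mul0r.
Qed.

Lemma wtvec_coord mu v i : wtvec rho mu v -> coordv v i 0 != 0 -> wt i = mu.
Proof.
move=> hv ci; apply/eqP; rewrite -subr_eq0; apply/eqP.
apply: (hform_nondeg Hg) => b; rewrite hformDl hformNl.
rewrite (@qpow_inj (hform (wt i) (hvec b)) (hform mu (hvec b))) ?subrr ?wt_int //.
have := coordv_rho (UK b) v; rewrite hv coordvZ => /colP/(_ i).
rewrite !mxE (bigD1 i) //= rho_mx_UK eqxx mul1r big1 => [|j ji].
  rewrite addr0 mxE => /eqP; rewrite eq_sym -subr_eq0 -mulrBl mulf_eq0.
  by move: ci; rewrite mxE => /negbTE ->; rewrite orbF subr_eq0 => /eqP.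
by rewrite rho_mx_UK eq_sym (negbTE ji) !mul0r.
Qed.

Lemma is_weight_wt mu : is_weight rho mu -> exists i, wt i = mu.
Proof.
move=> [v v0 hv].
suff /existsP[i hi] : [exists i, coordv v i 0 != 0].
  by exists i; apply: wtvec_coord hi.
apply: contraT; rewrite negb_exists => /forallP h.
case/eqP: v0; apply: coordv_inj; apply/colP => i.
by rewrite [RHS]mxE; apply/eqP; rewrite -[_ == _]negbK h.
Qed.

Lemma mulUK b x i j :
  rmx (UK b * x) i j = qpow (hform (wt i) (hvec b)) * rmx x i j.
Proof.
have [_ -> _] := rho_mx_hom; rewrite [LHS]mxE (bigD1 i) //= rho_mx_UK eqxx mul1r.
rewrite big1 ?addr0 // => k ki.
by rewrite rho_mx_UK eq_sym (negbTE ki) !mul0r.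
Qed.

Lemma mulUKr b x i j :
  rmx (x * UK b) i j = rmx x i j * qpow (hform (wt j) (hvec b)).
Proof.
have [_ -> _] := rho_mx_hom; rewrite [LHS]mxE (bigD1 j) //= rho_mx_UK eqxx mul1r.
rewrite big1 ?addr0 // => k ki.
by rewrite rho_mx_UK (negbTE ki) !(mul0r, mulr0).
Qed.

(** Comparing the entries of K_c x and x K_c gives an equality of powers of q for every c, and the
    form is nondegenerate. *)
Lemma Udeg_rho_mx b x i j : Udeg b x -> rmx x i j != 0 -> wt i - wt j = hvec b.
Proof.
move=> hx xij; apply/eqP; rewrite -subr_eq0; apply/eqP.
apply: (hform_nondeg Hg) => c; rewrite !hformDl !hformNl.
have := congr1 (fun y => rmx y i j) (Udeg_comm c hx).
have [_ hM hK] := rho_mx_hom; rewrite mulUK hM hK.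
rewrite mx_kinE [X in _ = X]mxE mulUKr.
rewrite mulrCA mulrC => /(mulfI xij); rewrite /qform -qpowD ?hform_int ?wt_int //.
move=> /qpow_inj ->; rewrite ?wt_int //; ring.
Qed.

(** If K_a and its inverse agree on V, every weight is orthogonal to alpha_a. A nonzero entry of F_a
    would join two weights whose pairings with alpha_a differ by (alpha_a, alpha_a) > 0. *)
Lemma rho_mx_KK a : rmx (UK (sroot a) - UK (- sroot a)) = 0 -> rmx (UF a) = 0.
Proof.
move=> h; have z i : hform (wt i) (hvec (sroot a)) = 0.
  have /matrixP/(_ i i) := h; rewrite (alg_homB rho_mx_hom) !mxE.
  have := rho_mx_UK (sroot a) i i; have := rho_mx_UK (- sroot a) i i.
  rewrite !mxE eqxx !mul1r => -> -> /eqP; rewrite subr_eq0 => /eqP.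
  move=> /(qpow_inj (wt_int _ _)); rewrite hvecN hformNr => /eqP.
  by rewrite -addr_eq0 -mulr2n mulrn_eq0 => /eqP.
apply/matrixP => i j; rewrite [RHS]mxE; apply/eqP/negPn/negP => ne.
have := Udeg_rho_mx (UF_deg Hg a) ne => /(congr1 (fun y : hdual g => hform y (hvec (sroot a)))).
rewrite hformDl hformNl !z subrr hvecN hformNl => /esym/eqP; rewrite oppr_eq0.
case: Hg => _ _ _ pos _; apply/negP; rewrite gt_eqF // pos //.
by rewrite -(hvec0 g) (inj_eq (@hvec_inj g)) sroot_neq0.
Qed.

(** When E_a acts by 0, so does [E_a, F_a], hence also K_a - K_a^-1. *)
Lemma UE0_UF0 a : rmx (UE a) = 0 -> rmx (UF a) = 0.
Proof.
move=> h; apply: rho_mx_KK.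
have := congr1 rmx (UEF a a); rewrite (alg_homB rho_mx_hom).
have [_ hM hK] := rho_mx_hom; rewrite !hM hK h mul0r mulr0 subrr eqxx.
rewrite mx_kinE => /esym/eqP; rewrite scaler_eq0.
case/orP => [|/eqP //]; rewrite mul1r invr_eq0 subr_eq0 => /eqP hq.
(* A vanishing coefficient would mean q_a = q_a^-1, that is q^(2 d_a) = 1 with d_a > 0. *)
have /qvarX_eq1/eqP : qvar ^+ (symd g a + symd g a) = 1.
  by rewrite exprD -/(qi a) {2}hq divff // expf_neq0 // qvar_neq0.
have [_ _ [pos _ _] _ _] := Hg.
by rewrite addn_eq0 andbb (gtn_eqF (pos a)).
Qed.

(** * Weights below the highest one, and the highest weight line *)

Section HighestWeight.
Variables (lam : hdual g) (v0 : V).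
Hypotheses (Hirr : irreducible_rep rho) (v0n : v0 != 0) (v0w : wtvec rho lam v0)
  (Ev0 : forall i, rho (UE i) v0 = 0).

Lemma hw_ind (P : 'cV[Qq]_n -> Prop) : P (coordv v0) ->
  (forall s t, P s -> P t -> P (s + t)) -> (forall (a : Qq) s, P s -> P (a *: s)) ->
  (forall a s, P s -> P (rmx (UF a) *m s)) -> forall i, P (delta_mx i 0).
Proof.
move=> P0 PD PZ PF i; rewrite -coordv_e.
elim: (Fspan_full Hg Hrep Hirr v0n v0w Ev0 (tnth e i)) => // [a u _|u v _ hu _|a u _].
- by rewrite coordv_rho; apply: PF.
- by rewrite coordvD; apply: PD.
- by rewrite coordvZ; apply: PZ.
Qed.

Lemma UF_entry a i j : rmx (UF a) i j != 0 -> wt j = wt i + hvec (sroot a).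
Proof.
move=> /(Udeg_rho_mx (UF_deg Hg a)); rewrite hvecN => h.
by rewrite -[hvec _]opprK -h opprB addrC subrK.
Qed.

Lemma wt_Qplus i : hQplus (lam - wt i).
Proof.
pose P (s : 'cV[Qq]_n) := forall j, s j 0 != 0 -> hQplus (lam - wt j).
suff : P (delta_mx i 0) by apply; rewrite mxE !eqxx oner_neq0.
apply: (@hw_ind P) => [j /(wtvec_coord v0w) ->|s t hs ht j|a s hs j|a s hs j].
- by rewrite subrr hQplus0.
- rewrite mxE; case: (eqVneq (s j 0) 0) => [->|/hs //]; rewrite add0r; exact: ht.
- by rewrite mxE mulf_eq0 negb_or => /andP[_ /hs].
rewrite mxE => h; have /existsP[k] : [exists k, rmx (UF a) j k * s k 0 != 0].
  apply: contraT; rewrite negb_exists => /forallP h0; case/eqP: h.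
  by rewrite big1 // => k _; apply/eqP; rewrite -[_ == _]negbK h0.
rewrite mulf_eq0 negb_or => /andP[/UF_entry wk /hs]; rewrite wk => hk.
have -> : lam - wt j = (lam - (wt j + hvec (sroot a))) + hvec (sroot a).
  by rewrite opprD addrA subrK.
by apply: hQplusD => //; rewrite hvec_Qplus sroot_Qplus.
Qed.

(** An image under F_a has no component of weight [lam], since that component would come from weight
    [lam] + alpha_a. So the weight [lam] part of any vector is a multiple of [v0], and two distinct
    basis vectors of this weight cannot both be such multiples. *)
Lemma hw_line i j : wt i = lam -> wt j = lam -> i = j.
Proof.
pose P (s : 'cV[Qq]_n) :=
  exists c : Qq, forall k, wt k = lam -> s k 0 = c * coordv v0 k 0.
have h k : P (delta_mx k 0).
  apply: (@hw_ind P) => [|s t [c hs] [d ht]|a s [c hs]|a s _].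
  - by exists 1 => l _; rewrite mul1r.
  - by exists (c + d) => l hl; rewrite mxE hs // ht // mulrDl.
  - by exists (a * c) => l hl; rewrite mxE hs // mulrA.
  exists 0 => l hl; rewrite mul0r mxE big1 // => m _.
  apply/eqP; rewrite mulf_eq0; apply/orP; left; apply/negPn/negP => /UF_entry hm.
  have := wt_Qplus m; rewrite hm hl opprD addrA subrr add0r => hq.
  have := hQplus_pointed _ hq; rewrite hvec_Qplus sroot_Qplus => /(_ isT).
  rewrite -(hvec0 g) => /(@hvec_inj g) ; exact/eqP/sroot_neq0.
move=> hi hj; have [c hc] := h i; have [d hd] := h j.
have := hc j hj; have := hc i hi; have := hd j hj; have := hd i hi.
rewrite !mxE !eqxx /= !andbT [j == i]eq_sym; case: eqP => // _ /=.
move=> /eqP; rewrite eq_sym mulf_eq0 => /orP[/eqP ->|/eqP ->].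
  by rewrite mul0r => /eqP; rewrite oner_eq0.
by move=> _; rewrite mulr0 => /eqP; rewrite oner_eq0.
Qed.

Hypothesis Hdom : dominant_integral lam.

(** Both weights lie in [lam] minus the root lattice, so expanding the form cancels (lam, lam).
    Integrality is what makes the coefficients of D nonzero. *)
Lemma wt_form_int i j : hform (wt i) (wt j) - hform lam lam \is a Num.int.
Proof.
have /hQplusP[b _ hb] := wt_Qplus i; have /hQplusP[c _ hc] := wt_Qplus j.
have -> : wt i = lam - hvec b by rewrite -hb subKr.
have -> : wt j = lam - hvec c by rewrite -hc subKr.
rewrite hformDl !hformDr !hformNl !hformNr (hformC Hg (hvec b) lam).
have -> : hform lam lam - hform lam (hvec c) + (- hform lam (hvec b) -
  - hform (hvec b) (hvec c)) - hform lam lam = hform (hvec b) (hvec c)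
  - hform lam (hvec c) - hform lam (hvec b) by ring.
by do 2?apply: rpredB; rewrite ?hform_int ?(dominant_hform_int Hg).
Qed.

End HighestWeight.
End WeightBasis.

(** * The R-matrix *)

Section TensorAlgebra.
Variables (K : comNzRingType) (A B : kalgType K).

Lemma tensorM (x x' : A) (y y' : B) :
  (x \ox y) * (x' \ox y') = (x * x') \ox (y * y').
Proof.
rewrite /tensor (alg_homM (@tensl_hom K A B)) (alg_homM (@tensr_hom K A B)).
by rewrite -!mulrA; congr (_ * _); rewrite !mulrA tenslr.
Qed.

Lemma tensorBr (x : A) (y y' : B) : x \ox (y - y') = x \ox y - x \ox y'.
Proof. by rewrite /tensor (alg_homB (@tensr_hom K A B)) mulrBr. Qed.

End TensorAlgebra.

Lemma tensmx_eq0 (F : fieldType) m n p q (M : 'M[F]_(m, n)) (N : 'M[F]_(p, q)) :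
  M *t N = 0 -> M = 0 \/ N = 0.
Proof.
move=> h; case: (eqVneq M 0) => [|/matrix0Pn[i [j Mij]]]; [by left | right].
apply/matrixP => k l; have /matrixP/(_ (mxtens_index (i, k)) (mxtens_index (j, l))) := h.
by rewrite tensmxE !mxE => /eqP; rewrite mulf_eq0 (negbTE Mij) => /eqP.
Qed.

Lemma sum_mxtens (R : nmodType) m n (F : 'I_(m * n) -> R) :
  \sum_x F x = \sum_i \sum_j F (mxtens_index (i, j)).
Proof.
rewrite pair_bigA (reindex (@mxtens_index m n)) /=.
  by apply: eq_bigr => -[].
by exists (@mxtens_unindex m n) => ? _; [exact: mxtens_indexK | exact: mxtens_unindexK].
Qed.

Lemma tensmx_scalar (R : pzRingType) m n (a b : R) :
  (a%:M : 'M_m) *t (b%:M : 'M_n) = (a * b)%:M.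
Proof.
apply/matrixP => x y; case: (mxtens_indexP x) (mxtens_indexP y) => i j [k l].
rewrite tensmxE !mxE (can_eq (@mxtens_indexK m n)) xpair_eqE.
by do 2!case: eqP => _; rewrite ?mulr0 ?mul0r.
Qed.

Section RMatrix.
Variable g : lie_datum.
Hypothesis Hg : simple_datum g.
Variables (V : vectType Qq) (rho : Uq g -> 'End(V)).
Hypothesis Hrep : is_rep rho.
Variables (n : nat) (e : n.-tuple V) (wt : 'I_n -> hdual g).
Hypothesis He : weight_basis rho e wt.

Local Notation rmx := (rho_mx rho e).
Local Notation rmx2 := (rho2_mx rho e).
Let rh := rho_mx_hom Hrep He.

Lemma rho_tens1_hom :
  @alg_hom Qq (Uq g) 'M[Qq]_(n * n) (fun x => rmx x *t 1%:M).
Proof.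
split=> [x y|x y|a].
- rewrite (alg_homD rh); apply/matrixP => i j; by rewrite !mxE mulrDl.
- by rewrite (alg_homM rh) -[RHS]/(_ *m _) tensmx_mul mulmx1.
- by rewrite (alg_homK rh) -[LHS]/(a%:M *t 1%:M) tensmx_scalar mulr1.
Qed.

Lemma rho_1tens_hom :
  @alg_hom Qq (Uq g) 'M[Qq]_(n * n) (fun x => 1%:M *t rmx x).
Proof.
split=> [x y|x y|a].
- rewrite (alg_homD rh); apply/matrixP => i j; by rewrite !mxE mulrDr.
- by rewrite (alg_homM rh) -[RHS]/(_ *m _) tensmx_mul mulmx1.
- by rewrite (alg_homK rh) -[LHS]/(1%:M *t a%:M) tensmx_scalar mul1r.
Qed.

Lemma rho_tens_comm x y : (rmx x *t 1%:M) * (1%:M *t rmx y) =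
  (1%:M *t rmx y) * (rmx x *t 1%:M) :> 'M[Qq]_(n * n).
Proof.
by rewrite -[LHS]/(_ *m _) -[RHS]/(_ *m _) !tensmx_mul !mulmx1 !mul1mx.
Qed.

Lemma rho2_hom : alg_hom rmx2.
Proof. exact: tens_lift_hom rho_tens1_hom rho_1tens_hom rho_tens_comm. Qed.

Lemma rho2_tensor x y : rmx2 (x \ox y) = rmx x *t rmx y.
Proof.
rewrite /rho2_mx (tens_liftE rho_tens1_hom rho_1tens_hom rho_tens_comm).
by rewrite -[LHS]/(_ *m _) tensmx_mul mulmx1 mul1mx.
Qed.

Lemma rho2_span P Q u i j k l : tens_span P Q u ->
  rmx2 u (mxtens_index (i, j)) (mxtens_index (k, l)) != 0 ->
  exists x y, [/\ P x, Q y, rmx x i k != 0 & rmx y j l != 0].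
Proof.
move=> [s [hs ->]]; rewrite (alg_hom_sum rho2_hom) big_seq summxE => h.
have /hasP[p ps hp] : has (fun p => (rmx p.1 i k != 0) && (rmx p.2 j l != 0)) s.
  apply: contraT => /hasPn hn; case/eqP: h; rewrite big1 // => p /hn.
  by rewrite -negb_or negbK rho2_tensor tensmxE => /orP[]/eqP ->; rewrite ?mul0r ?mulr0.
have [Px Qy] := hs p ps; case/andP: hp => h1 h2.
by exists p.1, p.2; split; [exact Px | exact Qy | exact h1 | exact h2].
Qed.

(** The simple root part of the nilpotent subalgebra is needed only through its action on V, so an
    induction over the subalgebra is enough. The statement also tracks degree 0, where elements act
    by scalars: by indecomposability of alpha_a, a product reaches degree alpha_a only through
    degrees 0 and alpha_a of its factors. Taking [w] to be [wt] for the E_i and its opposite for the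
    F_i treats both signs at once. *)
Lemma subalg_simple (S : 'I_(rk g) -> Uq g) (w : 'I_n -> hdual g) :
  (forall a k l, rmx (S a) k l != 0 -> w k - w l = hvec (sroot a)) ->
  forall x, subalg (fun y => exists i, y = S i) x ->
  exists a0 c, [/\ forall k l, rmx x k l != 0 -> hQplus (w k - w l),
    forall k l, w k = w l -> rmx x k l = a0 * (k == l)%:R
    & forall a k l, w k - w l = hvec (sroot a) -> rmx x k l = c a * rmx (S a) k l].
Proof.
move=> hS x; elim=> {x} [_ [b ->]|a|x y _ [a0 [c [h1 h2 h3]]] _ [b0 [d [k1 k2 k3]]]
  |x y _ [a0 [c [h1 h2 h3]]] _ [b0 [d [k1 k2 k3]]]].
- exists 0, (fun a => (a == b)%:R); split=> [k l /hS ->|k l wkl|a k l wkl].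
  + by rewrite hvec_Qplus sroot_Qplus.
  + rewrite mul0r; apply/eqP/negPn/negP => /hS; rewrite wkl subrr -(hvec0 g).
    by move/(@hvec_inj g)/esym; apply/eqP/sroot_neq0.
  + case: eqP => [->|ab]; first by rewrite mul1r.
    rewrite mul0r; apply/eqP/negPn/negP => /hS; rewrite wkl.
    by move/(@hvec_inj g)/sroot_inj.
- exists a, (fun=> 0); rewrite (alg_homK rh); split=> [k l|k l _|b k l wkl].
  + by rewrite mxE; case: (k =P l) => [->|]; rewrite ?subrr ?hQplus0 ?eqxx.
  + by rewrite mxE mulr_natr.
  + rewrite mul0r mxE; case: (k =P l) wkl => // ->; rewrite subrr -(hvec0 g).
    by move/(@hvec_inj g)/esym/eqP; rewrite (negbTE (sroot_neq0 b)).
- exists (a0 + b0), (fun a => c a + d a); rewrite (alg_homD rh).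
  split=> [k l|k l wkl|a k l wkl]; rewrite mxE.
  + by case: (eqVneq (rmx x k l) 0) => [->|/h1 //]; rewrite add0r; apply: k1.
  + by rewrite h2 // k2 // mulrDl.
  + by rewrite (h3 a) // (k3 a) // mulrDl.
have split1 k m l : rmx x k m * rmx y m l != 0 ->
    [/\ hQplus (w k - w m), hQplus (w m - w l) & (w k - w m) + (w m - w l) = w k - w l].
  by rewrite mulf_eq0 negb_or => /andP[/h1 ? /k1 ?]; split=> //; rewrite addrA subrK.
(* Scalars multiply, and simple root coefficients obey the Leibniz rule. *)
exists (a0 * b0), (fun a => a0 * d a + c a * b0); rewrite (alg_homM rh).
split=> [k l|k l wkl|a k l wkl]; rewrite mxE.
- move=> h; have /existsP[m /split1[p1 p2 <-]] : [exists m, rmx x k m * rmx y m l != 0].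
    apply: contraT; rewrite negb_exists => /forallP h0; case/eqP: h.
    by rewrite big1 // => m _; apply/eqP; rewrite -[_ == _]negbK h0.
  exact: hQplusD.
- rewrite (bigD1 k) //= big1 ?addr0 => [|m mk].
    by rewrite h2 // k2 // eqxx mulr1 mulrA.
  apply/eqP/negPn/negP => h; have [p1 p2] := split1 _ _ _ h.
  have zkl : w k - w l = 0 by rewrite wkl subrr.
  rewrite zkl => ps; have [/eqP] := hQplus_sum0 p1 p2 ps.
  rewrite subr_eq0 => /eqP wkm _.
  by case/eqP: h; rewrite (h2 k m wkm) eq_sym (negbTE mk) mulr0 mul0r.
have kl : k != l.
  apply/eqP => kl; move: wkl; rewrite kl subrr -(hvec0 g).
  by move/(@hvec_inj g)/esym/eqP; rewrite (negbTE (sroot_neq0 a)).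
rewrite (bigD1 k) //= (bigD1 l) 1?eq_sym //= big1 ?addr0 => [|m /andP[mk ml]].
  by rewrite h2 // (k2 l l) // (h3 a) // (k3 a) // !eqxx !mulr1; ring.
apply/eqP/negPn/negP => h; have [p1 p2] := split1 _ _ _ h.
rewrite wkl => ps; have [p0|pa] := sroot_split p1 p2 ps.
  move/eqP: p0; rewrite subr_eq0 => /eqP wkm.
  by case/eqP: h; rewrite (h2 k m wkm) eq_sym (negbTE mk) mulr0 mul0r.
have /eqP : w m - w l = 0 by apply: (addrI (w k - w m)); rewrite ps pa addr0.
rewrite subr_eq0 => /eqP wml.
by case/eqP: h; rewrite (k2 m l) // (negbTE ml) !mulr0.
Qed.

Lemma Unplus_simple a x : Unplus x -> Udeg (sroot a) x ->
  exists c, rmx x = c *: rmx (UE a).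
Proof.
move=> hx dx; have [|a0 [c [_ _ h]]] := @subalg_simple _ wt _ _ hx.
  by move=> b k l; apply: (Udeg_rho_mx Hg Hrep He); apply: UE_deg.
exists (c a); apply/matrixP => k l; rewrite [RHS]mxE.
case: (eqVneq (wt k - wt l) (hvec (sroot a))) => [/h -> //|ne].
have z y : Udeg (sroot a) y -> rmx y k l = 0.
  move=> dy; apply/eqP/negPn/negP => /(Udeg_rho_mx Hg Hrep He dy).
  exact/eqP.
by rewrite !z ?mulr0 //; apply: UE_deg.
Qed.

Lemma Unminus_simple a x : Unminus x -> Udeg (- sroot a) x ->
  exists c, rmx x = c *: rmx (UF a).
Proof.
move=> hx dx; have [|a0 [c [_ _ h]]] := @subalg_simple _ (fun i => - wt i) _ _ hx.
  move=> b k l /(Udeg_rho_mx Hg Hrep He (UF_deg Hg b)) hkl.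
  by rewrite -opprD hkl hvecN opprK.
exists (c a); apply/matrixP => k l; rewrite [RHS]mxE.
case: (eqVneq (wt k - wt l) (hvec (- sroot a))) => [hk|ne].
  by apply: h; rewrite -opprD hk hvecN opprK.
have z y : Udeg (- sroot a) y -> rmx y k l = 0.
  move=> dy; apply/eqP/negPn/negP => /(Udeg_rho_mx Hg Hrep He dy).
  exact/eqP.
by rewrite !z ?mulr0 //; apply: UF_deg.
Qed.

Lemma rho2_simple a u :
  tens_span (fun x => Unplus x /\ Udeg (sroot a) x)
            (fun y => Unminus y /\ Udeg (- sroot a) y) u ->
  exists C : Qq, rmx2 u = C *: (rmx (UE a) *t rmx (UF a)).
Proof.
move=> [s [hs ->]]; rewrite (alg_hom_sum rho2_hom) big_seq.
elim/big_ind: _ => [|_ _ [C ->] [D ->]|p /hs[[h1 h2] [h3 h4]]].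
- by exists 0; rewrite scale0r.
- by exists (C + D); rewrite scalerDl.
have [c hc] := Unplus_simple h1 h2; have [d hd] := Unminus_simple h3 h4.
exists (c * d); rewrite rho2_tensor hc hd; apply/matrixP => i j.
by rewrite !mxE; ring.
Qed.

End RMatrix.

(** * The simple root component and the support of the R-matrix *)

Section Intertwiner.
Variable g : lie_datum.
Hypothesis Hg : simple_datum g.
Local Notation UU := (tens (Uq g) (Uq g)).

Lemma Qinterval_sroot (a : 'I_(rk g)) (nu : Qlat g) :
  Qinterval (sroot a) nu -> nu \in [:: 0; sroot a].
Proof.
move=> /andP[h1 h2]; have hs : hvec nu + hvec (sroot a - nu) = hvec (sroot a).
  by rewrite -hvecD addrC subrK.
rewrite -hvec_Qplus in h1; rewrite -hvec_Qplus in h2.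
rewrite !inE; have [h|/(@hvec_inj g) ->] := sroot_split h1 h2 hs.
  by rewrite -(hvec0 g) in h; rewrite (hvec_inj h) eqxx.
by rewrite eqxx orbT.
Qed.

Lemma Qinterval_sum (M : zmodType) (a : 'I_(rk g)) (f : Qlat g -> M) :
  \sum_(nu \in Qinterval (sroot a)) f nu = f 0 + f (sroot a).
Proof.
rewrite (fsbigE [:: 0; sroot a]).
- have Q0 : Qplus (0 : Qlat g) by apply/forallP => k; rewrite mxE.
  rewrite !big_cons big_nil !ifT /= ?addr0 //; apply: mem_set; rewrite /Qinterval /=.
    by rewrite subrr sroot_Qplus.
  by rewrite subr0 sroot_Qplus andbT.
- by rewrite /= inE eq_sym sroot_neq0.
- move=> nu /=; rewrite !inE => /orP[]/eqP ->; rewrite /Qinterval /=.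
    by rewrite subr0 sroot_Qplus andbT; apply/forallP => k; rewrite mxE.
  by rewrite subrr sroot_Qplus; apply/forallP => k; rewrite mxE.
- by move=> nu /Qinterval_sroot ->.
Qed.

(** The relations defining R+ are quantified over families of homogeneous components, so the
    coproduct of E_a needs an explicit one: first leg of degree [b] for [u], of degree 0 for [v]. *)
Definition two_components (b : Qlat g) (u v : UU) (c : Qlat g) : UU :=
  if c == b then u else if c == 0 then v else 0.

Lemma two_componentsP (b : Qlat g) (x1 y1 x2 y2 : Uq g) : b != 0 ->
  Udeg b x1 -> Udeg 0 x2 ->
  components (@leg1_deg g) (x1 \ox y1 + x2 \ox y2)
    (two_components b (x1 \ox y1) (x2 \ox y2)).
Proof.
move=> b0 h1 h2; have tens1 c x y : Udeg c x -> leg1_deg c (x \ox y : UU).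
  move=> hx; exists [:: (x, y)]; rewrite big_seq1; split=> // p.
  by rewrite inE => /eqP ->.
split=> [c|].
  rewrite /two_components; case: eqP => [->|_]; first exact: tens1.
  case: eqP => [->|_]; first exact: tens1.
  by exists [::]; rewrite big_nil.
exists [:: b; 0]; split.
- by rewrite /= inE b0.
- by move=> c; rewrite !inE negb_or /two_components => /andP[/negbTE -> /negbTE ->].
- by rewrite !big_cons big_nil addr0 /two_components eqxx eq_sym (negbTE b0) eqxx.
Qed.

Variables (Delta : Uq g -> UU) (Psi : UU -> UU) (Rp : Qlat g -> UU).
Hypotheses (HDelta : is_coproduct Delta) (HPsi : is_Psi Psi)
  (HR : is_Rplus Delta Psi Rp).

Lemma Delta_Psi_op_UE a :
  tens_flip (Psi (Delta (UE a))) = UE a \ox UK (- sroot a) + 1 \ox UE a.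
Proof.
have [_ _ DE _] := HDelta; have [Ph PK PE1 PE2] := HPsi.
have fh : alg_hom (@tens_flip Qq (Uq g) (Uq g)).
  apply: tens_lift_hom; [exact: tensr_hom | exact: tensl_hom |].
  by move=> x y; rewrite tenslr.
have e1 : UE a \ox UK (sroot a) = (UE a \ox 1) * (1 \ox UK (sroot a)) :> UU.
  by rewrite tensorM mulr1 mul1r.
rewrite DE (alg_homD Ph) e1 (alg_homM Ph).
have [-> _] := PE1 a; have [-> _] := PE2 a; have [_ ->] := PK (sroot a).
by rewrite tensorM mulr1 UKN (alg_homD fh) !tens_flipE addrC.
Qed.

(** This is the degree alpha_a part of the intertwining relation for E_a: only nu = 0, with R_0 = 1,
    and nu = alpha_a contribute. The twist by Psi turns K_a into K_a^-1 in one of the two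
    coproducts, whence the difference. *)
Lemma Rplus_UE_comm a :
  UE a \ox (UK (sroot a) - UK (- sroot a))
    + (Rp (sroot a) * (1 \ox UE a) - (1 \ox UE a) * Rp (sroot a)) = 0.
Proof.
have [_ _ DE _] := HDelta; have [_ R1 RE _] := HR.
have d0 : Udeg 0 (1 : Uq g).
  by move=> c; rewrite mulr1 UKNr /qform (hvec0 g) hform0l qpow0 kin1 mul1r.
have bE : Ubplus (UE a : Uq g).
  by apply: subalg_gen; left; apply: subalg_gen; exists a.
have c1 := two_componentsP (UK (sroot a)) (UE a) (sroot_neq0 a) (UE_deg Hg a) d0.
have c2 := two_componentsP (UK (- sroot a)) (UE a) (sroot_neq0 a) (UE_deg Hg a) d0.
rewrite -DE in c1; rewrite -Delta_Psi_op_UE in c2.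
have := RE _ _ (sroot_Qplus a) bE _ _ c1 c2.
rewrite Qinterval_sum subr0 subrr R1 mul1r mulr1 /two_components eqxx.
rewrite [0 == _]eq_sym (negbTE (sroot_neq0 a)) eqxx.
by rewrite tensorBr.
Qed.

Variables (V : vectType Qq) (rho : Uq g -> 'End(V)).
Hypothesis Hrep : is_rep rho.
Variables (n : nat) (e : n.-tuple V) (wt : 'I_n -> hdual g).
Hypothesis He : weight_basis rho e wt.

Local Notation rmx := (rho_mx rho e).
Local Notation rmx2 := (rho2_mx rho e).
Let r2h := rho2_hom Hrep He.

(** If [C] is 0, the relation for E_a becomes E_a (x) (K_a - K_a^-1) = 0 on V (x) V, so one of the
    tensor factors is 0; either case gives F_a = 0. *)
Lemma Rplus_sroot a : exists C : Qq,
  rmx2 (Rp (sroot a)) = C *: (rmx (UE a) *t rmx (UF a)) /\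
  (rmx (UF a) = 0 \/ C != 0 /\ rmx (UE a) != 0).
Proof.
have [Rt _ _ _] := HR.
have [C hC] := rho2_simple Hg Hrep He (Rt _ (sroot_Qplus a)).
exists C; split=> //.
have [E0|En] := eqVneq (rmx (UE a)) 0; first by left; apply: (UE0_UF0 Hg Hrep He E0).
have [C0|Cn] := eqVneq C 0; last by right.
left; have := congr1 rmx2 (Rplus_UE_comm a).
rewrite (alg_homD r2h) (rho2_tensor Hrep He) (alg_homB r2h) !(alg_homM r2h).
rewrite hC C0 scale0r mul0r mulr0 subrr addr0 (alg_hom0 r2h) => /tensmx_eq0[E0|].
  by rewrite E0 eqxx in En.
exact: (rho_mx_KK Hg Hrep He).
Qed.

Variable lam : hdual g.

Local Notation R := (Rmx rho e wt lam Rp).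
Local Notation R4 i j k l := (R (mxtens_index (i, j)) (mxtens_index (k, l))).

Definition Dcoef i j : Qq := qpow (hform (wt i) (wt j) - hform lam lam).

Lemma Dmx_entry (i j k l : 'I_n) :
  Dmx wt lam (mxtens_index (i, j)) (mxtens_index (k, l)) =
  ((i == k) && (j == l))%:R * Dcoef i j.
Proof.
rewrite /Dmx summxE (bigD1 i) //= summxE (bigD1 j) //= !big1 ?addr0.
- rewrite mxE tensmxE !mxE !eqxx /= mulrC; congr (_ * _).
  by rewrite ![k == _]eq_sym ![l == _]eq_sym; do 2!case: (_ == _); rewrite ?mulr0 ?mulr1.
- move=> m mi; rewrite summxE big1 // => p _.
  by rewrite mxE tensmxE !mxE (eq_sym i) (negbTE mi) mul0r mulr0.
- by move=> m mj; rewrite mxE tensmxE !mxE (eq_sym j) (negbTE mj) mulr0 mulr0.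
Qed.

Lemma Dmx_mulE (M : 'M[Qq]_(n * n)) (i j k l : 'I_n) :
  (Dmx wt lam *m M) (mxtens_index (i, j)) (mxtens_index (k, l)) =
  Dcoef i j * M (mxtens_index (i, j)) (mxtens_index (k, l)).
Proof.
rewrite mxE sum_mxtens (bigD1 i) //= (bigD1 j) //= !big1 ?addr0.
- by rewrite Dmx_entry !eqxx mul1r.
- move=> m mi; rewrite big1 // => p _.
  by rewrite Dmx_entry (eq_sym i) (negbTE mi) !mul0r.
- by move=> m mj; rewrite Dmx_entry eqxx (eq_sym j) (negbTE mj) !mul0r.
Qed.

Let S := \sum_(nu \in [set nu : Qlat g | Qplus nu]%classic) rmx2 (Rp nu).

Lemma Rmx_entry (i j k l : 'I_n) :
  R4 i j k l = Dcoef i j * S (mxtens_index (i, j)) (mxtens_index (k, l)).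
Proof. exact: Dmx_mulE. Qed.

Lemma Rplus_supp nu i j k l : Qplus nu ->
  rmx2 (Rp nu) (mxtens_index (i, j)) (mxtens_index (k, l)) != 0 ->
  wt i - wt k = hvec nu /\ wt i + wt j = wt k + wt l.
Proof.
have [Rt _ _ _] := HR => /Rt ht /(rho2_span Hrep He ht)[x [y [[_ dx] [_ dy]]]].
move=> /(Udeg_rho_mx Hg Hrep He dx) h1 /(Udeg_rho_mx Hg Hrep He dy) h2; split=> //.
move/eqP: h2; rewrite hvecN -h1 opprB subr_eq => /eqP ->.
by rewrite addrA [wt i + _]addrC subrK.
Qed.

(** A finite list containing every nu for which R_nu acts nontrivially, since such a nu is a
    difference of two weights; it turns the sum over the whole cone into a finite one. *)
Let diffs : seq (Qlat g) :=
  undup [seq nu <- [seq \row_m numq ((wt p.1 - wt p.2) 0 m) | p <- enum {: 'I_n * 'I_n}]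
    | Qplus nu].

Lemma Rplus_sum_seq : S = \sum_(nu <- diffs) rmx2 (Rp nu).
Proof.
have inQ nu : nu \in diffs -> Qplus nu by rewrite mem_undup mem_filter => /andP[].
rewrite /S (fsbigE diffs); last 1 first.
- move=> nu /= hnu; apply: contraNeq => /matrix0Pn[x [y]].
  case: (mxtens_indexP x) (mxtens_indexP y) => i j [k l] /(Rplus_supp hnu)[h _].
  rewrite mem_undup mem_filter hnu; apply/mapP; exists (i, k); first by rewrite mem_enum.
  by rewrite /= h; apply/rowP => m; rewrite !mxE numq_int.
- rewrite big_seq_cond [RHS]big_seq_cond; apply: eq_bigl => nu.
  by rewrite andbT; case h: (nu \in diffs) => //=; rewrite mem_set //=; apply: inQ.
- exact: undup_uniq.
- by move=> nu /= /inQ.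
Qed.

Lemma Rmx_supp i j k l : R4 i j k l != 0 ->
  hQplus (wt i - wt k) /\ wt i + wt j = wt k + wt l.
Proof.
rewrite Rmx_entry mulf_eq0 negb_or => /andP[_]; rewrite Rplus_sum_seq summxE big_seq => h.
have /hasP[nu hin hnu] : has (fun nu =>
    rmx2 (Rp nu) (mxtens_index (i, j)) (mxtens_index (k, l)) != 0) diffs.
  apply: contraT => /hasPn hn; case/eqP: h; rewrite big1 // => nu /hn.
  by rewrite negbK => /eqP.
move: hin; rewrite mem_undup mem_filter => /andP[hq _].
have [h1 h2] := Rplus_supp hq hnu; split; last exact h2.
by rewrite h1 hvec_Qplus.
Qed.

Lemma Rmx_entry_deg nu i j k l : Qplus nu -> wt i - wt k = hvec nu ->
  R4 i j k l = Dcoef i j * rmx2 (Rp nu) (mxtens_index (i, j)) (mxtens_index (k, l)).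
Proof.
move=> hq hik; rewrite Rmx_entry Rplus_sum_seq summxE; congr (_ * _).
have z nu' : Qplus nu' -> nu' != nu ->
    rmx2 (Rp nu') (mxtens_index (i, j)) (mxtens_index (k, l)) = 0.
  move=> hq' ne; apply/eqP/negPn/negP => /(Rplus_supp hq')[h _].
  by case/eqP: ne; apply: (@hvec_inj g); rewrite -h.
rewrite (bigD1_seq nu) /= ?undup_uniq //.
  rewrite big_seq_cond big1 ?addr0 // => nu'.
  by rewrite mem_undup mem_filter => /andP[/andP[h _]]; apply: z.
rewrite mem_undup mem_filter hq; apply/mapP; exists (i, k); first by rewrite mem_enum.
by rewrite /= hik; apply/rowP => m; rewrite !mxE numq_int.
Qed.

(** Equal weights in the first leg isolate the term nu = 0, where R_0 = 1 leaves only D. *)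
Lemma Rmx_diag i j k l : wt i = wt k ->
  R4 i j k l = ((i == k) && (j == l))%:R * Dcoef i j.
Proof.
move=> hik; have [_ R1 _ _] := HR.
rewrite (@Rmx_entry_deg 0) ?hik ?subrr ?hvec0 //; last by apply/forallP => m; rewrite mxE.
rewrite R1 (alg_hom1 r2h) mxE (can_eq (@mxtens_indexK n n)) xpair_eqE.
by rewrite mulrC.
Qed.

End Intertwiner.

(** * The RTT relations *)

Section TensorEntries.
Variables (A : pzRingType) (n : nat) (M N : 'M[A]_n).

Lemma tensmx12_entry i j k l :
  ((M *t 1%:M) *m (1%:M *t N)) (mxtens_index (i, j)) (mxtens_index (k, l)) =
  M i k * N j l.
Proof.
rewrite mxE sum_mxtens (bigD1 k) //= (bigD1 j) //= !big1 ?addr0.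
- by rewrite !tensmxE !mxE !eqxx mulr1 mul1r.
- move=> p pk; rewrite big1 // => q _.
  by rewrite !tensmxE !mxE (negbTE pk) mul0r mulr0.
- by move=> q qj; rewrite !tensmxE !mxE (eq_sym j) (negbTE qj) mulr0 mul0r.
Qed.

Lemma tensmx21_entry i j k l :
  ((1%:M *t N) *m (M *t 1%:M)) (mxtens_index (i, j)) (mxtens_index (k, l)) =
  N j l * M i k.
Proof.
rewrite mxE sum_mxtens (bigD1 i) //= (bigD1 l) //= !big1 ?addr0.
- by rewrite !tensmxE !mxE !eqxx mulr1 mul1r.
- move=> p pk; rewrite big1 // => q _.
  by rewrite !tensmxE !mxE (eq_sym i) (negbTE pk) !mul0r.
- by move=> q qj; rewrite !tensmxE !mxE (negbTE qj) mulr0 mulr0.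
Qed.

End TensorEntries.

Lemma kin_unit (A : kalgType Qq) (a : Qq) (x y : A) : a != 0 ->
  a%:K * x = a%:K * y -> x = y.
Proof.
move=> a0 h; rewrite -[x]mul1r -[y]mul1r -(@kin1 _ A) -(mulVf a0) kinM -!mulrA.
by rewrite h.
Qed.

Lemma kin_shuffle (A : kalgType Qq) (x y : A) (d c e f : Qq) :
  x * y * (d * (c * (e * f)))%:K = (d * c)%:K * ((x * f%:K) * (y * e%:K)).
Proof.
have -> : (x * f%:K) * (y * e%:K) = (f * e)%:K * (x * y).
  rewrite -(kin_central f) -(kin_central e) kinM -!mulrA; congr (_ * _).
  by rewrite !mulrA kin_central.
rewrite -[LHS]kin_central [RHS]mulrA -kinM; congr (_%:K * _).
by rewrite [f * e]mulrC mulrA.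
Qed.

Lemma comm_kin (A : kalgType Qq) (x : A) (a : Qq) : GRing.comm x a%:K.
Proof. exact/esym/kin_central. Qed.

Section RTT.
Variables (g : lie_datum) (n : nat) (wt : 'I_n -> hdual g) (R : 'M[Qq]_(n * n)).

Local Notation R4 i j k l := (R (mxtens_index (i, j)) (mxtens_index (k, l))).
Local Notation U := (UR wt R).
Local Notation L := (Lmx wt R).
Local Notation L0 s := (degpart wt 0 (Lmx wt R s)).

Lemma Lmx_supp s i j : L s i j != 0 ->
  hQplus (if s then wt i - wt j else wt j - wt i).
Proof.
have hom := qclass_hom (@URrel g n wt R).
apply: contraR => h; rewrite !mxE.
by case: s h => h; rewrite insubN //; apply/eqP; exact: alg_hom0 hom.
Qed.

Lemma degpart_map s b :
  degpart wt b (L s) = map_mx (qclass (@URrel g n wt R)) (degpart wt b (Lfree wt s)).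
Proof.
by apply/matrixP => i j; rewrite !mxE; case: ifP.
Qed.

Lemma L0_mulV s : L0 s *m L0 (~~ s) = 1%:M.
Proof.
have hom := qclass_hom (@URrel g n wt R).
rewrite !degpart_map -(map_alg_homM hom); apply/matrixP => i j.
rewrite [LHS]mxE; have := ideal_gen (URrel_inv wt R s i j).
rewrite -[X in ideal _ X]subr0 => /qclass_eq.
rewrite [X in qclass _ X]mxE (alg_homD hom) (alg_hom0 hom).
rewrite [X in _ + qclass _ X]mxE (alg_homN hom) => /eqP; rewrite subr_eq0 => /eqP ->.
by rewrite !mxE; case: eqP => _; rewrite ?(alg_hom1 hom) ?(alg_hom0 hom).
Qed.

(** The condition on the signs excludes only the pair (-,+), for which no relation is imposed. *)
Lemma RLL s t i j k l : s || ~~ t ->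
  \sum_p \sum_q (R4 i j p q)%:K * (L s p k * L t q l) =
  \sum_p \sum_q (L t j q * L s i p) * (R4 p q k l)%:K :> U.
Proof.
move=> hst; have hom := qclass_hom (@URrel g n wt R).
have : @URrel g n wt R (URcomm wt R s t (mxtens_index (i, j)) (mxtens_index (k, l))).
  by case: s t hst => -[] // _; [apply: URrel_ss|apply: URrel_pm|apply: URrel_ss].
move/ideal_gen; rewrite -[X in ideal _ X]subr0 => /qclass_eq.
rewrite /URcomm mxE (alg_homD hom) (alg_hom0 hom) [X in _ + qclass _ X]mxE.
rewrite (alg_homN hom) => /eqP; rewrite subr_eq0 => /eqP.
rewrite -mulmxA !mxE !(alg_hom_sum hom) !sum_mxtens => h.
transitivity (\sum_p \sum_q qclass (@URrel g n wt R) (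
  map_mx (fun a : Qq => a%:K : freealg Qq (Lgens wt)) R (mxtens_index (i, j))
    (mxtens_index (p, q)) *
  ((Lfree wt s *t 1%:M) *m (1%:M *t Lfree wt t)) (mxtens_index (p, q))
    (mxtens_index (k, l)))).
  apply: eq_bigr => p _; apply: eq_bigr => q _.
  by rewrite tensmx12_entry !(alg_homM hom) !mxE.
rewrite h; apply: eq_bigr => p _; apply: eq_bigr => q _.
by rewrite tensmx21_entry !(alg_homM hom) !mxE.
Qed.

End RTT.
Lemma mulr_neq0W (A : pzRingType) (x y : A) : x * y != 0 -> x != 0 /\ y != 0.
Proof.
by move=> h; split; apply: contraNneq h => ->; rewrite ?mul0r ?mulr0.
Qed.

Lemma comm_mxP (A : pzRingType) m (x : A) (M : 'M[A]_m) :
  (forall i j, GRing.comm x (M i j)) <-> x%:M *m M = M *m x%:M.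
Proof.
have e i j : (M *m x%:M) i j = M i j * x.
  rewrite mxE (bigD1 j) //= mxE eqxx mulr1n big1 ?addr0 // => k kj.
  by rewrite mxE (negbTE kj) mulr0n mulr0.
split=> [h|/matrixP h i j]; last first.
  by have := h i j; rewrite e mul_scalar_mx mxE.
by apply/matrixP => i j; rewrite e mul_scalar_mx mxE h.
Qed.

(** * Consequences of the RTT relations for triangular matrices *)

Section RTTCore.
Variables (g : lie_datum) (n : nat) (wt : 'I_n -> hdual g) (R : 'M[Qq]_(n * n)).
Variables (D : 'I_n -> 'I_n -> Qq) (A : kalgType Qq) (L : bool -> 'M[A]_n).

Local Notation R4 i j k l := (R (mxtens_index (i, j)) (mxtens_index (k, l))).
Local Notation L0 s := (degpart wt 0 (L s)).

Hypothesis L_supp : forall s i j, L s i j != 0 ->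
  hQplus (if s then wt i - wt j else wt j - wt i).
Hypothesis L0_mulV : forall s, L0 s *m L0 (~~ s) = 1%:M.
Hypothesis RLL : forall s t i j k l, s || ~~ t ->
  \sum_p \sum_q (R4 i j p q)%:K * (L s p k * L t q l) =
  \sum_p \sum_q (L t j q * L s i p) * (R4 p q k l)%:K.
Hypothesis R_supp : forall i j k l, R4 i j k l != 0 ->
  hQplus (wt i - wt k) /\ wt i + wt j = wt k + wt l.
Hypothesis R_diag : forall i j k l, wt i = wt k ->
  R4 i j k l = ((i == k) && (j == l))%:R * D i j.
Hypothesis D_neq0 : forall i j, D i j != 0.
Hypothesis D_wt : forall i j k l, wt i = wt k -> wt j = wt l -> D i j = D k l.

Lemma sum_R_diagl i j (X : 'I_n -> 'I_n -> A) :
  (forall p q, X p q != 0 -> R4 i j p q != 0 -> wt i = wt p) ->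
  \sum_p \sum_q (R4 i j p q)%:K * X p q = (D i j)%:K * X i j.
Proof.
move=> h; have z p q : ~~ ((i == p) && (j == q)) -> (R4 i j p q)%:K * X p q = 0.
  move=> ne; have [->|X0] := eqVneq (X p q) 0; first by rewrite mulr0.
  have [->|R0] := eqVneq (R4 i j p q) 0; first by rewrite kin0 mul0r.
  by rewrite (R_diag _ _ (h p q X0 R0)) (negbTE ne) mul0r kin0 mul0r.
rewrite (bigD1 i) //= (bigD1 j) //= !big1 ?addr0.
- by rewrite (R_diag _ _ erefl) !eqxx mul1r.
- by move=> p pi; rewrite big1 // => q _; apply: z; rewrite eq_sym (negbTE pi).
- by move=> q qj; apply: z; rewrite eqxx eq_sym.
Qed.

Lemma sum_R_diagr k l (X : 'I_n -> 'I_n -> A) :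
  (forall p q, X p q != 0 -> R4 p q k l != 0 -> wt p = wt k) ->
  \sum_p \sum_q X p q * (R4 p q k l)%:K = (D k l)%:K * X k l.
Proof.
move=> h; have z p q : ~~ ((p == k) && (q == l)) -> X p q * (R4 p q k l)%:K = 0.
  move=> ne; have [->|X0] := eqVneq (X p q) 0; first by rewrite mul0r.
  have [->|R0] := eqVneq (R4 p q k l) 0; first by rewrite kin0 mulr0.
  by rewrite (R_diag _ _ (h p q X0 R0)) (negbTE ne) mul0r kin0 mulr0.
rewrite (bigD1 k) //= (bigD1 l) //= !big1 ?addr0.
- by rewrite (R_diag _ _ erefl) !eqxx mul1r kin_central.
- by move=> p pi; rewrite big1 // => q _; apply: z; rewrite (negbTE pi).
- by move=> q qj; apply: z; rewrite eqxx.
Qed.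

Lemma wt_opp_diff i j p q : wt i + wt j = wt p + wt q -> wt j - wt q = - (wt i - wt p).
Proof.
move=> h; apply/eqP; rewrite -addr_eq0 addrACA [wt j + _]addrC h.
by rewrite -opprD [wt q + _]addrC subrr.
Qed.

Lemma wt_eqP i j : reflect (wt i = wt j) (wt i - wt j == 0).
Proof. by rewrite subr_eq0; apply: eqP. Qed.

(** When one of the two entries has degree 0, the degree contributed by R in the first leg lies both
    in the cone and in its opposite, on either side of the relation. It is therefore 0, and R
    reduces to D. *)
Lemma RLL_pm i j k l : wt i = wt k \/ wt j = wt l ->
  (D i j)%:K * (L true i k * L false j l) =
  (D k l)%:K * (L false j l * L true i k).
Proof.
move=> hw; have := @RLL true false i j k l isT.
rewrite sum_R_diagl; last first.
  move=> p q /mulr_neq0W[/L_supp h1 /L_supp h2] /R_supp[h3 /wt_opp_diff h4].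
  apply/wt_eqP/eqP; apply: hQplus_pointed => //.
  case: hw => [hik|hjl]; first by rewrite opprB hik.
  by rewrite -h4 hjl.
rewrite sum_R_diagr // => p q /mulr_neq0W[/L_supp h1 /L_supp h2].
move=> /R_supp[h3 /wt_opp_diff h4]; apply/wt_eqP/eqP; apply: hQplus_pointed => //.
case: hw => [hik|hjl]; first by rewrite opprB -hik.
by rewrite -h4 -hjl.
Qed.

(** Again only D survives, and its two coefficients agree because they depend only on weights; they
    cancel. *)
Lemma RLL_pp_diag i j k l : wt i = wt k -> wt j = wt l ->
  L true i k * L true j l = L true j l * L true i k.
Proof.
move=> hik hjl; have := @RLL true true i j k l isT.
rewrite sum_R_diagl; last first.
  move=> p q /mulr_neq0W[/L_supp h1 /L_supp h2] /R_supp[h3 h4].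
  by apply/wt_eqP/eqP; apply: hQplus_pointed => //; rewrite opprB hik.
rewrite sum_R_diagr => [|p q /mulr_neq0W[/L_supp h1 /L_supp h2] /R_supp[h3 h4]].
  by rewrite (D_wt hik hjl); apply: kin_unit.
by apply/wt_eqP/eqP; apply: hQplus_pointed => //; rewrite opprB -hik.
Qed.

Lemma L0E s i j : L0 s i j = if wt i == wt j then L s i j else 0.
Proof. by rewrite mxE hvec0 subr_eq0. Qed.

Lemma L0_comm i j k l : GRing.comm (L0 true i j) (L0 true k l).
Proof.
rewrite /GRing.comm !L0E; case: eqP => hij; last by rewrite mul0r mulr0.
by case: eqP => hkl; [apply: RLL_pp_diag | rewrite mul0r mulr0].
Qed.

Definition L0_commutant (x : A) := forall i j, GRing.comm x (L0 true i j).

(** Multiply x L0 = L0 x on both sides by the inverse matrix. *)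
Lemma L0_commutantV x i j : L0_commutant x -> GRing.comm x (L0 false i j).
Proof.
move=> /comm_mxP hx; move: i j; apply/comm_mxP.
have e1 : L0 false *m L0 true = 1%:M := L0_mulV false.
have e2 : L0 true *m L0 false = 1%:M := L0_mulV true.
transitivity (L0 false *m L0 true *m x%:M *m L0 false); first by rewrite e1 mul1mx.
by rewrite -(mulmxA (L0 false)) -hx !mulmxA -mulmxA e2 mulmx1.
Qed.

(* In the application [d] is a simple root alpha_a, and [E], [F] are the matrices
   of E_a, F_a on V. *)
Section SimpleRoot.
Variables (d : hdual g) (C : Qq) (E F : 'M[Qq]_n).
Hypotheses (C0 : C != 0) (E0 : E != 0).
Hypothesis E_deg : forall i j, E i j != 0 -> wt i - wt j = d.
Hypothesis F_deg : forall i j, F i j != 0 -> wt i - wt j = - d.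
Hypothesis R_root : forall i j k l, wt i - wt k = d ->
  R4 i j k l = D i j * (C * (E i k * F j l)).

Local Notation kmx M := (map_mx (fun a : Qq => a%:K : A) M).

Lemma kmx_neq0 (M : 'M[Qq]_n) i j : kmx M i j != 0 -> M i j != 0.
Proof. by apply: contraNneq; rewrite mxE => ->; rewrite kin0. Qed.

Lemma L0_neq0 s i j : L0 s i j != 0 -> wt i = wt j.
Proof. by rewrite L0E; case: (wt i =P wt j) => // _; rewrite eqxx. Qed.

(** In bidegree (d, -d) the degrees of the two [L+] factors lie in the cone and sum to 0, because R
    preserves total weight. Both are thus 0, only [L0] enters, and R contributes its degree [d] term
    D C (E (x) F), whose scalar D C is the same on both sides and cancels. *)
Lemma RLL_pp_simple i j k l :
  (kmx E *m L0 true) i k * (kmx F *m L0 true) j l =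
  (L0 true *m kmx F) j l * (L0 true *m kmx E) i k.
Proof.
(* Outside bidegree (d, -d) both sides vanish for degree reasons. *)
have [hik|nik] := eqVneq (wt i - wt k) d; last first.
  rewrite ![_ i k]mxE big1 => [|p _]; last first.
    apply/eqP/negPn/negP => /mulr_neq0W[/kmx_neq0/E_deg h /L0_neq0 h'].
    by case/eqP: nik; rewrite -h h'.
  rewrite big1 ?mul0r ?mulr0 // => p _.
  apply/eqP/negPn/negP => /mulr_neq0W[/L0_neq0 h' /kmx_neq0/E_deg h].
  by case/eqP: nik; rewrite -h h'.
have [hjl|njl] := eqVneq (wt j - wt l) (- d); last first.
  rewrite ![_ j l]mxE big1 => [|p _]; last first.
    apply/eqP/negPn/negP => /mulr_neq0W[/kmx_neq0/F_deg h /L0_neq0 h'].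
    by case/eqP: njl; rewrite -h h'.
  rewrite big1 ?mul0r ?mulr0 // => p _.
  apply/eqP/negPn/negP => /mulr_neq0W[/L0_neq0 h' /kmx_neq0/F_deg h].
  by case/eqP: njl; rewrite -h h'.
have hs : wt i + wt j = wt k + wt l.
  apply/eqP; rewrite -subr_eq0 opprD addrACA hik hjl; exact/eqP/subrr.
have DC0 : D i j * C != 0 := mulf_neq0 (D_neq0 i j) C0.
have := @RLL true true i j k l isT.
have -> : \sum_p \sum_q (R4 i j p q)%:K * (L true p k * L true q l) =
    (D i j * C)%:K * ((kmx E *m L0 true) i k * (kmx F *m L0 true) j l).
  rewrite ![_ i k]mxE ![_ j l]mxE mulr_suml mulr_sumr; apply: eq_bigr => p _.
  rewrite mulr_sumr mulr_sumr; apply: eq_bigr => q _.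
  have [hpk|npk] := eqVneq (wt p) (wt k); last first.
    rewrite [L0 true p k]L0E (negbTE npk) mulr0 mul0r mulr0.
    apply/eqP/negPn/negP => /mulr_neq0W[hR /mulr_neq0W[/L_supp h1 /L_supp h2]].
    have /R_supp[_ h3] : R4 i j p q != 0 by apply: contraNneq hR => ->; rewrite kin0.
    have h4 : (wt p - wt k) + (wt q - wt l) = 0.
      by rewrite addrACA -h3 hs -opprD subrr.
    by case/eqP: npk; have [/eqP] := hQplus_sum0 h1 h2 h4; rewrite subr_eq0 => /eqP.
  have [hql|nql] := eqVneq (wt q) (wt l); last first.
    rewrite [L0 true q l]L0E (negbTE nql) !mulr0.
    apply/eqP/negPn/negP => /mulr_neq0W[hR /mulr_neq0W[/L_supp h1 /L_supp h2]].
    have /R_supp[_ h3] : R4 i j p q != 0 by apply: contraNneq hR => ->; rewrite kin0.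
    have h4 : (wt p - wt k) + (wt q - wt l) = 0.
      by rewrite addrACA -h3 hs -opprD subrr.
    by case/eqP: nql; have [_ /eqP] := hQplus_sum0 h1 h2 h4; rewrite subr_eq0 => /eqP.
  rewrite !L0E hpk hql !eqxx R_root ?hpk // ![kmx _ _ _]mxE !kinM.
  rewrite -!mulrA; do 3!congr (_ * _).
  by rewrite !mulrA; congr (_ * _); rewrite kin_central.
have -> : \sum_p \sum_q (L true j q * L true i p) * (R4 p q k l)%:K =
    (D i j * C)%:K * ((L0 true *m kmx F) j l * (L0 true *m kmx E) i k).
  rewrite ![_ i k]mxE ![_ j l]mxE mulr_suml mulr_sumr exchange_big; apply: eq_bigr => q _.
  rewrite mulr_sumr mulr_sumr; apply: eq_bigr => p _.
  have hRz : (L true j q * L true i p) * (R4 p q k l)%:K != 0 ->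
      wt i = wt p /\ wt j = wt q.
    move=> /mulr_neq0W[/mulr_neq0W[/L_supp h2 /L_supp h1] hR].
    have /R_supp[_ h3] : R4 p q k l != 0 by apply: contraNneq hR => ->; rewrite kin0.
    have h4 : (wt i - wt p) + (wt j - wt q) = 0.
      by rewrite addrACA hs -h3 -opprD subrr.
    by have [/eqP + /eqP] := hQplus_sum0 h1 h2 h4; rewrite !subr_eq0 => /eqP ? /eqP ?.
  have [hpk|npk] := eqVneq (wt i) (wt p); last first.
    rewrite [L0 true i p]L0E (negbTE npk) mul0r !mulr0.
    by apply/eqP/negPn/negP => /hRz[/eqP h _]; rewrite h in npk.
  have [hql|nql] := eqVneq (wt j) (wt q); last first.
    rewrite [L0 true j q]L0E (negbTE nql) !(mul0r, mulr0).
    by apply/eqP/negPn/negP => /hRz[_ /eqP h]; rewrite h in nql.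
  rewrite !L0E hpk hql !eqxx R_root -?hpk // ![kmx _ _ _]mxE (D_wt hpk hql).
  exact: kin_shuffle.
exact: kin_unit.
Qed.

(** Multiplying the preceding relation by the inverse of [L0] in the first leg, and using
    commutativity of the entries of [L0], gives (L0^-1 E L0)_1 (F L0)_2 = E_1 (L0 F)_2. Reading a
    nonzero entry of E yields [z]. As a polynomial in the entries of [L0] and its inverse, [z] lies
    in the bicommutant of the entries of [L0]; the second clause records this so that the elements
    of different simple roots commute. *)
Lemma L0_F_scale :
  exists z, [/\ L0_commutant z, forall x, L0_commutant x -> GRing.comm x z
    & L0 true *m kmx F = z *: (kmx F *m L0 true)].
Proof.
have /matrix0Pn[i [k Eik]] := E0.
pose z := (E i k)^-1%:K * (L0 false *m kmx E *m L0 true) i k.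
have zc x : L0_commutant x -> GRing.comm x z.
  move=> hx; apply: commrM; first exact: comm_kin.
  rewrite mxE; apply: commr_sum => p _; apply: commrM; last exact: hx.
  rewrite mxE; apply: commr_sum => q _; apply: commrM; first exact: L0_commutantV.
  by rewrite [X in GRing.comm _ X]mxE; exact: comm_kin.
exists z; split=> //.
  by move=> p q; apply/commr_sym/zc => r s; apply: L0_comm.
apply/matrixP => j l; rewrite [RHS]mxE /z -mulrA.
have e1 : L0 false *m L0 true = 1%:M := L0_mulV false.
have LFc : L0_commutant ((L0 true *m kmx F) j l).
  move=> p q; apply: commr_sym; rewrite [X in GRing.comm _ X]mxE.
  apply: commr_sum => r _.
  by apply: commrM; [exact: L0_comm | rewrite [X in GRing.comm _ X]mxE; exact: comm_kin].
have LEc p : GRing.comm ((L0 true *m kmx F) j l) ((L0 true *m kmx E) p k).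
  rewrite [X in GRing.comm _ X]mxE; apply: commr_sum => r _.
  by apply: commrM; [exact: LFc | rewrite [X in GRing.comm _ X]mxE; exact: comm_kin].
have -> : (L0 false *m kmx E *m L0 true) i k * (kmx F *m L0 true) j l =
    (L0 false *m L0 true *m kmx E) i k * (L0 true *m kmx F) j l.
  rewrite -!mulmxA [X in X * _]mxE [in RHS]mxE !mulr_suml; apply: eq_bigr => p _.
  by rewrite -!mulrA RLL_pp_simple LEc.
by rewrite e1 mul1mx [kmx E i k]mxE mulrA -kinM mulVf // kin1 mul1r.
Qed.


End SimpleRoot.

End RTTCore.

Lemma map_kinM (A : kalgType Qq) m n p (M : 'M[Qq]_(m, n)) (N : 'M[Qq]_(n, p)) :
  map_mx (fun a : Qq => a%:K : A) (M *m N) =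
  map_mx (fun a : Qq => a%:K : A) M *m map_mx (fun a : Qq => a%:K : A) N.
Proof.
apply/matrixP => i j; rewrite !mxE.
rewrite (big_morph (fun a : Qq => a%:K : A) (@kinD Qq A) (@kin0 Qq A)).
by apply: eq_bigr => k _; rewrite kinM !mxE.
Qed.

Lemma prod_comm_expS (A : pzRingType) (I : finType) (z : I -> A) (N : I -> nat) b :
  (forall a c, GRing.comm (z a) (z c)) ->
  \prod_a z a ^+ (N a + (a == b)) = z b * \prod_a z a ^+ N a.
Proof.
move=> zc.
have h (s : seq I) : uniq s -> \prod_(a <- s) z a ^+ (N a + (a == b)) =
    (if b \in s then z b else 1) * \prod_(a <- s) z a ^+ N a.
  elim: s => [|a s IH] /=; first by rewrite !big_nil mul1r.
  case/andP => nas us; rewrite !big_cons IH // inE.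
  have [->|ne] := eqVneq b a.
    by rewrite (negbTE nas) mul1r /= addn1 exprS mulrA.
  rewrite addn0 /= !mulrA; congr (_ * _).
  by case: ifP => _; rewrite ?mulr1 ?mul1r //; apply/commr_sym/commrX/zc.
by rewrite h ?index_enum_uniq // mem_index_enum.
Qed.

(** * The action of [L0] carried down from the highest weight line *)

Section Eigenvalues.
Variables (g : lie_datum) (n : nat) (wt : 'I_n -> hdual g) (A : kalgType Qq).
Variables (L0 : 'M[A]_n) (F : 'I_(rk g) -> 'M[Qq]_n) (z : 'I_(rk g) -> A).
Variables (lam : hdual g) (s0 : 'cV[Qq]_n) (i0 : 'I_n).

Local Notation kmx M := (map_mx (fun a : Qq => a%:K : A) M).

Hypothesis L0_wt : forall i j, wt i <> wt j -> L0 i j = 0.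
Hypothesis F_wt : forall a i j, F a i j != 0 -> wt j = wt i + hvec (sroot a).
Hypothesis z_comm : forall a b, GRing.comm (z a) (z b).
Hypothesis L0_F : forall a, L0 *m kmx (F a) = z a *: (kmx (F a) *m L0).
Hypothesis wt_ge : forall i, hQplus (lam - wt i).
Hypothesis wt_i0 : wt i0 = lam.
Hypothesis wt_lam : forall i, wt i = lam -> i = i0.
Hypothesis s0_wt : forall i, s0 i 0 != 0 -> wt i = lam.
Hypothesis F_gen : forall P : 'cV[Qq]_n -> Prop, P s0 ->
  (forall s t, P s -> P t -> P (s + t)) -> (forall (a : Qq) s, P s -> P (a *: s)) ->
  (forall a s, P s -> P (F a *m s)) -> forall i, P (delta_mx i 0).

(** The coordinates of [lam - m] are natural numbers when [m] is a weight, so neither the numerator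
    nor the absolute value changes them. *)
Definition ell (m : hdual g) : A :=
  (\prod_a z a ^+ `|numq ((lam - m)%R 0%R a)|%N) * L0 i0 i0.

Lemma ell_step a i j : F a i j != 0 -> ell (wt i) = z a * ell (wt j).
Proof.
move=> /F_wt hj; rewrite /ell mulrA -(prod_comm_expS _ a z_comm); congr (_ * _).
apply: eq_bigr => b _; congr (_ ^+ _).
have -> : lam - wt i = (lam - wt j) + hvec (sroot a) by rewrite hj opprD addrA subrK.
have /forallP/(_ b)/natrP[m hm] := wt_ge j.
rewrite mxE hm hvec_sroot mxE eqxx /= -natrD.
by rewrite -[(m + _)%:R]/((m + (b == a))%:Z%:~R) -[m%:R]/(m%:Z%:~R) !numq_int.
Qed.

Lemma L0_eigen i j :
  L0 i j = (i == j)%:R * ell (wt i).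
Proof.
(* [P] says that [L0] multiplies each coordinate of [s] by the expected eigenvalue of its weight. It
   is linear in [s], and applying F_a multiplies the eigenvalue by z_a on both sides, so it spreads
   from [s0] to all of V. *)
pose P (s : 'cV[Qq]_n) :=
  forall k, (L0 *m kmx s) k 0 = ell (wt k) * (s k 0)%:K.
have hP : P (delta_mx j 0).
  apply: (@F_gen P) => [k|s1 s2 h1 h2 k|a s1 h1 k|a s1 h1 k].
  - have [s0k|s0k] := eqVneq (s0 k 0) 0; last first.
      rewrite (wt_lam (s0_wt s0k)) mxE (bigD1 i0) //= big1 => [|m mi].
        rewrite addr0 mxE; congr (_ * _).
        rewrite wt_i0 /ell subrr big1 ?mul1r // => a _.
        by rewrite mxE expr0.
      rewrite mxE; have [->|/s0_wt/wt_lam h] := eqVneq (s0 m 0) 0.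
        by rewrite kin0 mulr0.
      by rewrite h eqxx in mi.
    rewrite s0k kin0 mulr0 mxE big1 // => m _; rewrite mxE.
    have [->|sm] := eqVneq (s0 m 0) 0; first by rewrite kin0 mulr0.
    rewrite L0_wt ?mul0r // => hkm.
    have hm := s0_wt sm; rewrite hm in hkm.
    by rewrite (wt_lam hm) -(wt_lam hkm) s0k eqxx in sm.
  - have e : kmx (s1 + s2) = kmx s1 + kmx s2 by apply/colP => l; rewrite !mxE kinD.
    by rewrite e mulmxDr mxE h1 h2 [in RHS]mxE kinD mulrDr.
  - rewrite [in RHS]mxE kinM mulrA -(kin_central a (ell _)) -mulrA -h1 !mxE mulr_sumr.
    by apply: eq_bigr => m _; rewrite !mxE kinM !mulrA (kin_central a).
  rewrite map_kinM mulmxA L0_F -scalemxAl mxE -mulmxA mxE [in RHS]mxE.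
  rewrite (big_morph (fun a : Qq => a%:K : A) (@kinD Qq A) (@kin0 Qq A)).
  rewrite !mulr_sumr; apply: eq_bigr => m _; rewrite h1 mxE kinM.
  have [->|Fkm] := eqVneq (F a k m) 0; first by rewrite kin0 !(mul0r, mulr0).
  rewrite (ell_step Fkm) -[RHS]mulrA; congr (_ * _); move: (ell _) => x.
  by rewrite !mulrA kin_central.
have e : kmx (delta_mx j 0 : 'cV[Qq]_n) = delta_mx j 0.
  by apply/colP => k; rewrite !mxE; case: andb; rewrite ?kin0 ?kin1.
have := hP i; rewrite e -colE !mxE eqxx andbT => ->.
by case: eqP => _; rewrite ?kin0 ?kin1 ?mulr0 ?mul0r ?mulr1 ?mul1r.
Qed.

End Eigenvalues.

(** * Extending a conjugation rule from generators to homogeneous elements *)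

Section GradedConjugation.
Variables (g : lie_datum) (A : kalgType Qq) (G : Qlat g -> A -> Prop).
Hypothesis HG : is_grading G.
Variables (l l' : A) (q : Qlat g -> Qq).
Hypotheses (hl : is_inverse l l') (q0 : q 0 = 1)
  (qD : forall b c, q (b + c) = q b * q c).

Let Homog b x := G b x /\ l * x * l' = (q b)%:K * x.

(** Each summand is homogeneous and obeys the conjugation rule for its degree. Unlike the rule
    itself, this property is stable under sums of different degrees, so it can be checked on
    generators. *)
Definition homog_sum x := exists s : seq (Qlat g * A),
  (forall p, p \in s -> Homog p.1 p.2) /\ x = \sum_(p <- s) p.2.

Lemma homog_sum1 b x : G b x -> l * x * l' = (q b)%:K * x -> homog_sum x.
Proof.
move=> h1 h2; exists [:: (b, x)]; rewrite big_seq1; split=> // p.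
by rewrite inE => /eqP ->.
Qed.

Lemma homog_sumK (a : Qq) : homog_sum a%:K.
Proof.
case: HG => Gl G1 _ _ _; apply: (@homog_sum1 0).
  by rewrite -[a%:K]mulr1; case: (Gl 0) => _ _; apply.
by rewrite q0 kin1 mul1r -kin_central -mulrA (proj1 hl) mulr1.
Qed.

Lemma homog_sumD x y : homog_sum x -> homog_sum y -> homog_sum (x + y).
Proof.
move=> [s [hs ->]] [t [ht ->]]; exists (s ++ t); rewrite big_cat; split=> // p.
by rewrite mem_cat => /orP[/hs|/ht].
Qed.

Lemma homog_sum_sum (I : eqType) (s : seq I) (f : I -> A) :
  (forall i, i \in s -> homog_sum (f i)) -> homog_sum (\sum_(i <- s) f i).
Proof.
move=> h; rewrite big_seq; elim/big_ind: _ => // [|x y].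
  by rewrite -(@kin0 Qq A); apply: homog_sumK.
exact: homog_sumD.
Qed.

Lemma homog_sumM x y : homog_sum x -> homog_sum y -> homog_sum (x * y).
Proof.
move=> [s [hs ->]] [t [ht ->]]; rewrite mulr_suml; apply: homog_sum_sum => p ps.
rewrite mulr_sumr; apply: homog_sum_sum => r rt.
have [h1 h2] := hs p ps; have [h3 h4] := ht r rt.
case: HG => _ _ GM _ _; apply: (@homog_sum1 (p.1 + r.1)); first exact: GM.
have -> : l * (p.2 * r.2) * l' = (l * p.2 * l') * (l * r.2 * l').
  by rewrite !mulrA -(mulrA _ l' l) (proj2 hl) mulr1.
rewrite h2 h4 qD kinM -!mulrA; congr (_ * _).
by rewrite !mulrA kin_central.
Qed.

(** Group the summands of [x] by degree: the groups are components of [x] and obey the rule.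
    Uniqueness of components identifies the group of degree [b] with [x]. *)
Lemma graded_conj : (forall x, homog_sum x) ->
  forall b x, G b x -> l * x * l' = (q b)%:K * x.
Proof.
move=> hall b x Gx; have [Gl _ _ _ Guniq] := HG.
have [s [hs xs]] := hall x.
pose c d := \sum_(p <- s | p.1 == d) p.2.
have hc d : Homog d (c d).
  rewrite /c big_seq_cond; elim/big_ind: _ => [|u v [h1 h2] [h3 h4]|p /andP[ps /eqP <-]].
  - by case: (Gl d) => G0 _ _; split=> //; rewrite !(mulr0, mul0r).
  - case: (Gl d) => _ GD _; split; first exact: GD.
    by rewrite mulrDr mulrDl h2 h4 mulrDr.
  - exact: hs.
have cx : components G x c.
  split=> [d|]; first by case: (hc d).
  exists (undup [seq p.1 | p <- s]); split; first exact: undup_uniq.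
    move=> d; rewrite mem_undup => hd; rewrite /c big_seq_cond big1 // => p /andP[ps /eqP pd].
    by case/negP: hd; rewrite -pd map_f.
  rewrite xs (eq_bigr (fun d => \sum_(p <- s) if p.1 == d then p.2 else 0)); last first.
    by move=> d _; rewrite /c big_mkcond.
  rewrite exchange_big /= [LHS]big_seq [RHS]big_seq; apply: eq_bigr => p ps.
  rewrite (bigD1_seq p.1) ?undup_uniq ?mem_undup ?map_f //= eqxx big1 ?addr0 // => d.
  by rewrite eq_sym => /negbTE ->.
have c1 : components G x (fun d => if d == b then x else 0).
  split=> [d|]; first by case: eqP => [->|_] //; case: (Gl d).
  exists [:: b]; split=> //; last by rewrite big_seq1 eqxx.
  by move=> d; rewrite inE => /negbTE ->.
have e := Guniq _ _ _ cx c1 b; rewrite eqxx in e.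
by have [_] := hc b; rewrite e.
Qed.

End GradedConjugation.

Section URGenerators.
Variables (g : lie_datum) (n : nat) (wt : 'I_n -> hdual g) (R : 'M[Qq]_(n * n)).
Local Notation U := (UR wt R).

Lemma UR_ind (P : U -> Prop) :
  (forall s i j, P (Lmx wt R s i j)) -> (forall a : Qq, P a%:K) ->
  (forall u v, P u -> P v -> P (u + v)) ->
  (forall u v, P u -> P v -> P (u * v)) -> forall u, P u.
Proof.
move=> PL PK PD PM; apply: presalg_ind => // -[p|p].
  have := PL true (val p).1 (val p).2; rewrite !mxE.
  by case: p => -[i j] hp /=; rewrite insubT.
have := PL false (val p).1 (val p).2; rewrite !mxE.
by case: p => -[i j] hp /=; rewrite insubT.
Qed.

End URGenerators.

Lemma conj_qcomml (A : kalgType Qq) (l l' x : A) (d d' c : Qq) :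
  l * l' = 1 -> d != 0 -> d' = d * c ->
  d%:K * (x * l') = d'%:K * (l' * x) -> l * x * l' = c%:K * x.
Proof.
move=> ll' dn -> h; apply: (kin_unit dn).
have -> : d%:K * (l * x * l') = l * (d%:K * (x * l')).
  by rewrite [RHS]mulrA -(kin_central d l) -!mulrA.
by rewrite h [LHS]mulrA -(kin_central _ l) -mulrA (mulrA l) ll' mul1r kinM mulrA.
Qed.

Lemma conj_qcommr (A : kalgType Qq) (l l' x : A) (d d' c : Qq) :
  l * l' = 1 -> d != 0 -> d' = d * c ->
  d%:K * (l * x) = d'%:K * (x * l) -> l * x * l' = c%:K * x.
Proof.
move=> ll' dn -> h; apply: (kin_unit dn).
by rewrite mulrA h -!mulrA ll' mulr1 kinM mulrA.
Qed.

(** * The RTT analysis applied to the module V *)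

Section RepresentationRTT.
Variable g : lie_datum.
Hypothesis Hg : simple_datum g.
Variables (lam : hdual g) (lam_dom : dominant_integral lam).
Variables (V : vectType Qq) (rho : Uq g -> 'End(V)).
Hypothesis Hrep : is_rep rho.
Hypothesis Hirr : irreducible_rep rho.
Variable v0 : V.
Hypotheses (v0n : v0 != 0) (v0w : wtvec rho lam v0)
  (Ev0 : forall i, rho (UE i) v0 = 0).
Variables (n : nat) (e : n.-tuple V) (wt : 'I_n -> hdual g).
Hypothesis He : weight_basis rho e wt.
Variables (Delta : Uq g -> tens (Uq g) (Uq g)).
Variables (Psi : tens (Uq g) (Uq g) -> tens (Uq g) (Uq g)).
Variables (Rp : Qlat g -> tens (Uq g) (Uq g)).
Hypotheses (HDelta : is_coproduct Delta) (HPsi : is_Psi Psi)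
  (HR : is_Rplus Delta Psi Rp).

Local Notation R := (Rmx rho e wt lam Rp).
Local Notation rmx := (rho_mx rho e).

Variables (A : kalgType Qq) (L : bool -> 'M[A]_n).
Local Notation L0 s := (degpart wt 0 (L s)).
Hypothesis L_supp : forall s i j, L s i j != 0 ->
  hQplus (if s then wt i - wt j else wt j - wt i).
Hypothesis L0_mulV : forall s, L0 s *m L0 (~~ s) = 1%:M.
Hypothesis RLL : forall s t i j k l, s || ~~ t ->
  \sum_p \sum_q (R (mxtens_index (i, j)) (mxtens_index (p, q)))%:K *
    (L s p k * L t q l) =
  \sum_p \sum_q (L t j q * L s i p) *
    (R (mxtens_index (p, q)) (mxtens_index (k, l)))%:K.

Let R_supp i j k l := @Rmx_supp g Hg Delta Psi Rp HR V rho Hrep n e wt He lam i j k l.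
Let R_diag i j k l := @Rmx_diag g Hg Delta Psi Rp HR V rho Hrep n e wt He lam i j k l.
Let wt_ge := wt_Qplus Hg Hrep He Hirr v0n v0w Ev0.
Let D_int := wt_form_int Hg Hrep He Hirr v0n v0w Ev0 lam_dom.

Lemma Dcoef_neq0 i j : Dcoef wt lam i j != 0.
Proof. by rewrite /Dcoef qpow_neq0. Qed.

Lemma Dcoef_wt i j k l : wt i = wt k -> wt j = wt l ->
  Dcoef wt lam i j = Dcoef wt lam k l.
Proof. by rewrite /Dcoef => -> ->. Qed.

Lemma L0_UF a : exists z : A,
  [/\ L0_commutant wt L z, forall x : A, L0_commutant wt L x -> GRing.comm x z
    & L0 true *m map_mx (fun c : Qq => c%:K : A) (rmx (UF a)) =
      z *: (map_mx (fun c : Qq => c%:K : A) (rmx (UF a)) *m L0 true)].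
Proof.
have [C [hC]] := Rplus_sroot Hg HDelta HPsi HR Hrep He a.
case=> [F0|[Cn En]].
  (* When F_a acts by 0 the commutation rule is vacuous, and 1 commutes with everything. *)
  exists 1; split=> [i j|x _|]; [exact/commr_sym/commr1 | exact: commr1 |].
  have -> : map_mx (fun c : Qq => c%:K : A) (rmx (UF a)) = 0.
    by rewrite F0; apply/matrixP => i j; rewrite !mxE kin0.
  by rewrite mulmx0 mul0mx scaler0.
apply: (L0_F_scale L_supp L0_mulV RLL R_supp R_diag Dcoef_neq0 Dcoef_wt Cn En
  (d := hvec (sroot a))) => [i j|i j|i j k l hik].
- exact: (Udeg_rho_mx Hg Hrep He (UE_deg Hg a)).
- by rewrite -hvecN; apply: (Udeg_rho_mx Hg Hrep He (UF_deg Hg a)).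
rewrite (Rmx_entry_deg Hg HR Hrep He lam j l (sroot_Qplus a) hik) hC.
by rewrite mxE tensmxE.
Qed.

Lemma L0_scalar : exists f : hdual g -> A,
  forall i j, L0 true i j = (i == j)%:R * f (wt i).
Proof.
have [z hz] := choice L0_UF.
have [i0 hi0] : exists i, wt i = lam.
  by apply: (is_weight_wt Hg Hrep He); exists v0.
exists (ell (L0 true) z lam i0) => i j.
apply: (@L0_eigen g n wt A (L0 true) (fun a => rmx (UF a)) z lam (coordv e v0) i0).
- by move=> k l /eqP kl; rewrite L0E (negbTE kl).
- by move=> a k l; apply: (UF_entry Hg Hrep He).
- by move=> a b; have [h1 _ _] := hz a; have [_ h2 _] := hz b; apply: h2.
- by move=> a; have [] := hz a.
- exact: wt_ge.
- exact: hi0.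
- by move=> k hk; apply: (hw_line Hg Hrep He Hirr v0n v0w Ev0 hk hi0).
- by move=> k; apply: (wtvec_coord Hg Hrep He v0w).
- move=> P P0 PD PZ PF.
  exact: (hw_ind Hg Hrep He Hirr v0n v0w Ev0 P0 PD PZ PF).
Qed.

(** Diagonality of the degree 0 part of [L+] alone reduces the diagonal entries of both products to
    a single term. *)
Lemma L0_diag_inverse i : is_inverse (L true i i) (L false i i).
Proof.
have [f hf] := L0_scalar.
have d s k l : L0 s k l = if wt k == wt l then L s k l else 0 by rewrite L0E.
have hii : L true i i = f (wt i).
  by have := hf i i; rewrite d !eqxx mul1r.
split.
  have /matrixP/(_ i i) := L0_mulV true; rewrite mxE (bigD1 i) //= big1.
    by rewrite addr0 !d !eqxx mxE eqxx.
  by move=> k ki; rewrite hf eq_sym (negbTE ki) !mul0r.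
have /matrixP/(_ i i) := L0_mulV false; rewrite mxE (bigD1 i) //= big1.
  by rewrite addr0 !d !eqxx mxE eqxx.
by move=> k ki; rewrite hf (negbTE ki) mul0r mulr0.
Qed.

(** Both signs follow from the mixed relation [RLL_pm]: an entry of [L+] is paired with the diagonal
    entry of [L-], and an entry of [L-] with that of [L+]. The scalar is the quotient of the
    coefficients of D at the weights of k and j. *)
Lemma L_conj i s j k b : wt j - wt k = hvec b ->
  L true i i * L s j k * L false i i =
  (qpow (- hform (wt i) (hvec b)))%:K * L s j k.
Proof.
move=> hjk; have [ll' _] := L0_diag_inverse i.
have hw : hform (wt k) (wt i) - hform lam lam =
    (hform (wt j) (wt i) - hform lam lam) + - hform (wt i) (hvec b).
  by rewrite -hjk hformDr hformNr !(hformC Hg (wt i)); ring.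
have hD : Dcoef wt lam k i = Dcoef wt lam j i * qpow (- hform (wt i) (hvec b)).
  rewrite /Dcoef hw; apply: qpowD; first exact: D_int.
  by rewrite rpredN; exact: (wt_int Hrep He).
have hDC p : Dcoef wt lam p i = Dcoef wt lam i p by rewrite /Dcoef (hformC Hg).
have RLLpm := RLL_pm L_supp RLL R_supp R_diag.
case: s.
  apply: (conj_qcomml ll' (Dcoef_neq0 j i) hD).
  by apply: RLLpm; right.
rewrite !hDC in hD; apply: (conj_qcommr ll' (Dcoef_neq0 i j) hD).
by apply: RLLpm; left.
Qed.

End RepresentationRTT.

Theorem theorem4p8 (g : lie_datum) (Hg : simple_datum g)
    (lam : hdual g) (lam_neq0 : lam != 0) (lam_dom : dominant_integral lam)
    (V : vectType Qq) (rho : Uq g -> 'End(V)) (HV : irrep_hw rho lam)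
    (n : nat) (e : n.-tuple V) (wt : 'I_n -> hdual g) (He : weight_basis rho e wt)
    (Delta : Uq g -> tens (Uq g) (Uq g)) (HDelta : is_coproduct Delta)
    (Psi : tens (Uq g) (Uq g) -> tens (Uq g) (Uq g)) (HPsi : is_Psi Psi)
    (Rplus : Qlat g -> tens (Uq g) (Uq g)) (HRplus : is_Rplus Delta Psi Rplus) :
  let R := Rmx rho e wt lam Rplus in
  let U := UR wt R in
  forall (DeltaR : U -> tens U U) (HDeltaR : is_coproductR DeltaR)
    (epsR : U -> Qq^o) (HepsR : is_counitR epsR)
    (G : Qlat g -> U -> Prop) (HG : is_gradingR G)
    (mu : hdual g) (Hmu : is_weight rho mu),
  exists l : U,
    [/\ unique (fun l : U => invertible l /\ Lblock wt R mu = id_block mu l) l,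
        grouplike DeltaR epsR l
      & forall (l' : U) (b : Qlat g) (x : U), is_inverse l l' -> G b x ->
          l * x * l' = (qpow (- hform mu (hvec b)))%:K * x].
Proof.
move=> R U DeltaR [Dh HD] epsR [_ Heps] G [HG HGL] mu Hmu.
have [Hrep Hirr [v0 [v0n v0w Ev0]]] := HV.
have [i0 hi0] := is_weight_wt Hg Hrep He Hmu.
pose L s : 'M[U]_n := Lmx wt R s.
have Ls : forall s i j, L s i j != 0 ->
  hQplus (if s then wt i - wt j else wt j - wt i) by exact: Lmx_supp.
have Lv : forall s, degpart wt 0 (L s) *m degpart wt 0 (L (~~ s)) = 1%:M.
  exact: L0_mulV.
have LR := RLL wt R.
have [f hf] := L0_scalar Hg lam_dom Hrep Hirr v0n v0w Ev0 He HDelta HPsi HRplus Ls Lv LR.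
have linv := L0_diag_inverse Hg lam_dom Hrep Hirr v0n v0w Ev0 He HDelta HPsi HRplus Ls Lv LR.
have conj := L_conj Hg lam_dom Hrep Hirr v0n v0w Ev0 He HDelta HPsi HRplus Ls Lv LR.
have Lf i j : wt i = wt j -> L true i j = (i == j)%:R * f (wt i).
  by move=> hij; rewrite -hf L0E hij eqxx.
have Lii : L true i0 i0 = f mu by rewrite Lf // eqxx mul1r hi0.
have inv0 : is_inverse (f mu) (L false i0 i0) by rewrite -Lii; apply: linv.
exists (f mu); split.
- split.
    split; first by exists (L false i0 i0).
    apply/matrixP => i j; rewrite [LHS]mxE [RHS]mxE -/(L true) hf.
    have [hi|_] := eqVneq (wt i) mu; last by rewrite andbF.
    have [<-|ij] := eqVneq i j; first by rewrite hi eqxx mul1r.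
    by rewrite mul0r; case: ifP.
  (* Uniqueness: the entry at a basis vector of weight [mu] reads off the element. *)
  move=> l' [_ hl']; have := congr1 (fun M : 'M_n => M i0 i0) hl'.
  by rewrite mxE [in RHS]mxE -/(L true) hf hi0 !eqxx mul1r.
- split.
    have hD : map_mx DeltaR (L true) =
        map_mx (@tensl _ U U) (L true) *m map_mx (@tensr _ U U) (L true) := HD true.
    have /matrixP/(_ i0 i0) := hD; rewrite [LHS]mxE [RHS]mxE Lii => ->.
    rewrite (bigD1 i0) //= big1 => [|k ki].
      by rewrite addr0 [map_mx _ _ _ _]mxE [map_mx (@tensr _ U U) _ _ _]mxE Lii.
    rewrite [map_mx _ _ _ _]mxE [map_mx (@tensr _ U U) _ _ _]mxE.
    have [z|/Ls h1] := eqVneq (L true i0 k) 0.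
      by rewrite z (alg_hom0 (@tensl_hom Qq U U)) mul0r.
    have [z|/Ls h2] := eqVneq (L true k i0) 0.
      by rewrite z (alg_hom0 (@tensr_hom Qq U U)) mulr0.
    (* If both entries are nonzero, the difference of the two weights and its opposite lie in the
       cone; the entry (i0, k) then has degree 0 and is off-diagonal, hence 0. *)
    have hw : wt i0 = wt k.
      by apply/wt_eqP/eqP; apply: hQplus_pointed; rewrite ?opprB.
    by rewrite (Lf _ _ hw) eq_sym (negbTE ki) mul0r (alg_hom0 (@tensl_hom Qq U U)) mul0r.
  have he : map_mx epsR (L true) = 1%:M := Heps true.
  by have /matrixP/(_ i0 i0) := he; rewrite [LHS]mxE [RHS]mxE Lii eqxx => ->.
move=> l' b x hl' Gx; pose q c := qpow (- hform mu (hvec c)).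
have el' : l' = L false i0 i0.
  by rewrite -[l']mul1r -(proj2 inv0) -mulrA (proj1 hl') mulr1.
have q0 : q 0 = 1 by rewrite /q hvec0 hform0r oppr0 qpow0.
have qD c d : q (c + d) = q c * q d.
  rewrite /q hvecD hformDr opprD; apply: qpowD; rewrite rpredN -hi0;
  exact: (wt_int Hrep He).
apply: (@graded_conj g U G HG (f mu) l' q _ b x Gx) => y.
elim/UR_ind: y => [s i j|a|u v hu hv|u v hu hv].
- have [z|/Ls h] := eqVneq (L s i j) 0.
    rewrite -/(L s) z -(@kin0 Qq U); exact: (homog_sumK HG hl' q0).
  (* A nonzero generator has its degree in the root lattice, up to the sign of the triangular part
     it belongs to. *)
  have [c hc] : exists c, wt i - wt j = hvec c.
    case: s h => /hQplusP[c _ hc]; first by exists c.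
    by exists (- c); rewrite hvecN -hc opprB.
  apply: (@homog_sum1 g U G (f mu) l' q c).
    by have := HGL s c i j; rewrite mxE hc eqxx.
  by rewrite el' -Lii /q -hi0; apply: conj.
- exact: (homog_sumK HG hl' q0).
- exact: homog_sumD hu hv.
- exact: (homog_sumM HG hl' q0 qD hu hv).
Qed.
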